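(* For every $d\in\mathbb{N}$ (with $d\ge 1$), every $\theta\in(0,1)$ and every $\delta>0$, in the pooled data problem with labels $\{0,1,\dots,d\}$ and sparsity $\theta$, there exist a randomised, non-adaptive pooling scheme $\boldsymbol{G}$ for $n$ items using $$m \le (1+\delta)\cdot\frac{1+\sqrt{\theta}}{1-\sqrt{\theta}}\cdot m_{\mathrm{QGT}}^{\mathrm{inf}},\qquad m_{\mathrm{QGT}}^{\mathrm{inf}} = 2\,\frac{1-\theta}{\theta}\,k,\quad k=\lfloor n^{\theta}\rfloor,$$ pools, and a polynomial-time algorithm that, given $\boldsymbol{G}$ and the vector of measurement results $\hat{\boldsymbol{\sigma}}_{\boldsymbol{G}}$, outputs the ground truth $\boldsymbol{\sigma}$ with high probability (i.e. with probability tending to $1$ as $n\to\infty$).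
   Context: Problem (sparse pooled data problem): $d\ge1$ is a fixed integer. There are $n$ items $x_1,\dots,x_n$. Fix $\theta_1,\dots,\theta_d\in(0,1)$, let $k_i=\lfloor n^{\theta_i}\rfloor$ for $i=1,\dots,d$, and set $\theta=\max_i\theta_i$ (the sparsity) and $k=\max_i k_i=\lfloor n^{\theta}\rfloor$. The ground truth $\boldsymbol{\sigma}=(\boldsymbol{\sigma}_1,\dots,\boldsymbol{\sigma}_n)$ is uniformly distributed over all vectors in $\{0,1,\dots,d\}^n$ that have exactly $k_i$ entries equal to $i$ for each $i=1,\dots,d$ (all remaining entries being $0$). The numbers $k_1,\dots,k_d$ are known to the algorithm. A pooling scheme is a collection of $m$ pools $a_1,\dots,a_m$, each an arbitrary subset of $\{x_1,\dots,x_n\}$ (each item is contained in a pool at most once). It is identified with the bipartite graph on items and pools in which $x_i$ is adjacent to $a_j$ iff $x_i\in a_j$. The measurement result of pool $a_j$ is the label histogram $\hat{\boldsymbol{\sigma}}_j=(\hat{\boldsymbol{\sigma}}_j(\omega))_{\omega\in\{0,\dots,d\}}$ with $\hat{\boldsymbol{\sigma}}_j(\omega)=\sum_{i:\,x_i\in a_j}\mathbf{1}\{\boldsymbol{\sigma}_i=\omega\}$, and $\hat{\boldsymbol{\sigma}}_{\boldsymbol{G}}=(\hat{\boldsymbol{\sigma}}_1,\dots,\hat{\boldsymbol{\sigma}}_m)$. Non-adaptive means all pools are fixed in advance and measured in parallel, so no pool depends on $\boldsymbol{\sigma}$ or on any measurement result; randomised means the pools may be random (independent of $\boldsymbol{\sigma}$).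 The probability in ''with high probability'' is over both $\boldsymbol{\sigma}$ and the randomness of the scheme. Polynomial time means polynomial in $n$. *)

(* Defs.v *)
From HB Require Import structures.
From mathcomp Require Import all_boot all_order all_algebra.
From mathcomp Require Import all_classical all_reals all_analysis.
Set Implicit Arguments.
Unset Strict Implicit.
Unset Printing Implicit Defensive.
Import Order.TTheory GRing.Theory Num.Theory.
Import numFieldNormedType.Exports.

(* A random-access machine with structured control flow.  The memory consists
   of infinite arrays of natural numbers, named by the program literals [a]
   below (so a program uses finitely many of them), with indirect addressing.
   Each assignment and each test costs one step.  There is no multiplication:
   t steps produce numbers of O(t) more bits than the input, so unit cost is
   polynomially equivalent to Turing machine time. *)

Definition memory := nat -> nat -> nat.

Inductive expr : Type :=
| Const of nat
| Get of nat & expr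
| Add of expr & expr
| Sub of expr & expr.

Inductive cmd : Type :=
| Skip
| Assign of nat & expr & expr
| Seq of cmd & cmd
| If of expr & cmd & cmd
| While of expr & cmd.

Fixpoint eval (s : memory) (e : expr) : nat :=
  match e with
  | Const c => c
  | Get a e1 => s a (eval s e1)
  | Add e1 e2 => eval s e1 + eval s e2
  | Sub e1 e2 => eval s e1 - eval s e2
  end.

Definition update (s : memory) (a i v : nat) : memory :=
  fun b j => if (b == a) && (j == i) then v else s b j.

(* [exec c s t s']: started in [s], [c] halts in [s'] after exactly [t] steps;
   a test succeeds when its value is nonzero. *)
Inductive exec : cmd -> memory -> nat -> memory -> Prop :=
| ExecSkip s : exec Skip s 1 s
| ExecAssign a i e s :
    exec (Assign a i e) s 1 (update s a (eval s i) (eval s e))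
| ExecSeq c1 c2 s1 s2 s3 t1 t2 :
    exec c1 s1 t1 s2 -> exec c2 s2 t2 s3 -> exec (Seq c1 c2) s1 (t1 + t2) s3
| ExecIfTrue e c1 c2 s t s' :
    eval s e != 0 -> exec c1 s t s' -> exec (If e c1 c2) s t.+1 s'
| ExecIfFalse e c1 c2 s t s' :
    eval s e = 0 -> exec c2 s t s' -> exec (If e c1 c2) s t.+1 s'
| ExecWhileTrue e c s1 t1 s2 t2 s3 :
    eval s1 e != 0 -> exec c s1 t1 s2 -> exec (While e c) s2 t2 s3 ->
    exec (While e c) s1 (t1 + t2).+1 s3
| ExecWhileFalse e c s : eval s e = 0 -> exec (While e c) s 1 s.

Definition load (ss : seq (seq nat)) : memory :=
  fun a i => nth 0 (nth [::] ss a) i.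

(* Label [0] is [ord0 : 'I_d.+1]; the label i in {1, ..., d} is [lift ord0] of
   the index i - 1 in ['I_d]. *)
Definition labelling (n d : nat) := {ffun 'I_n -> 'I_d.+1}.

Definition design (n m : nat) := {ffun 'I_m -> {set 'I_n}}.

Definition histograms (m d : nat) := {ffun 'I_m -> {ffun 'I_d.+1 -> nat}}.

Definition measure_design (n m d : nat) (G : design n m) (sigma : labelling n d)
    : histograms m d :=
  [ffun j => [ffun w => \sum_(i in G j) (sigma i == w : nat)]].

Definition ground_truths (n d : nat) (k : 'I_d -> nat) : {set labelling n d} :=
  [set sigma : labelling n d |
    [forall i : 'I_d, #|[set x | sigma x == lift ord0 i]| == k i]].

(* Array 0: n, m, k_1, ..., k_d.  Array 1: the m * n biadjacency matrix, pool
   by pool.  Array 2: the m * (d + 1) histogram entries, pool by pool. *)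
Definition encode_input (n m d : nat) (k : 'I_d -> nat) (G : design n m)
    (y : histograms m d) : memory :=
  load [:: [:: n, m & [seq k i | i <- enum 'I_d]];
           [seq (i \in G j : nat) | j <- enum 'I_m, i <- enum 'I_n];
           [seq y j w | j <- enum 'I_m, w <- enum 'I_d.+1]].

(* Polynomial time in n, in the worst case over all designs and all histogram
   vectors with entries at most n, by a single program for all n.  The output
   labelling is read from array 3. *)
Definition polynomial_time (d : nat) (k : nat -> 'I_d -> nat) (m : nat -> nat)
    (A : forall n, design n (m n) -> histograms (m n) d -> labelling n d)
    : Prop :=
  exists (c : cmd) (p : {poly nat}),
    forall (n : nat) (G : design n (m n)) (y : histograms (m n) d),
      (forall j w, y j w <= n) ->
      exists (t : nat) (s : memory),
        [/\ exec c (encode_input (k n) G y) t s,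
            t <= p.[n]%R
          & forall i : 'I_n, s 3 i = A n G y i].

Local Open Scope ring_scope.

Section Probability.
Variable R : realType.

Definition is_pmf (T : finType) (P : T -> R) : Prop :=
  (forall x, 0 <= P x) /\ \sum_x P x = 1.

(* The design has law [P], the ground truth is uniform on [ground_truths k] and
   independent of the design.  (The value is 0 when [ground_truths k] is empty,
   which happens only for finitely many n when k_i = floor (n ^ theta_i).) *)
Definition success_probability (n m d : nat) (k : 'I_d -> nat)
    (P : design n m -> R)
    (A : design n m -> histograms m d -> labelling n d) : R :=
  \sum_(G : design n m) \sum_(sigma in ground_truths n k)
    P G * #|ground_truths n k|%:R^-1
        * (A G (measure_design G sigma) == sigma)%:R.

(* floor (n ^ theta) *)
Definition sparsity_count (theta : R) (n : nat) : nat :=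
  Num.truncn (n%:R `^ theta).

Definition m_QGT_inf (theta : R) (n : nat) : R :=
  2 * ((1 - theta) / theta) * (sparsity_count theta n)%:R.

End Probability.

(* Main.v *)
(* The pools come in positions p = 1, 2, ..., each with T random pools and one
   counting pool.  Every item is hashed into a compartment; the counting pool of
   position p is compartment p, and a random pool of position p contains each
   item of the compartments 1, ..., p with probability 1/2.

   Items are decoded compartment by compartment and subtracted from the
   results.  When an item of compartment c is considered, the residual of a
   random pool at position c + l - 1 involves only about l compartments of
   undecoded items, whose number is known from the counting pools; so the
   centred residual, correlated with the membership of the item, carries noise
   of variance proportional to l.  With the weights 1/l the signal-to-noise
   ratio of the score is (T / kappa) * (1 + 1/2 + 1/3 + ...), about
   (m / k) * theta * ln n, where kappa bounds the load of a compartment.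
   Hoeffding's bound for the products of signs gives error probabilities
   n^(- tau^2 m theta / 2k) for the n items without the label and
   n^(- (1 - tau)^2 m theta / 2k) for the at most n^theta items with it.  Both
   union bounds succeed for tau = 1 / (1 + sqrt theta) as soon as
   m > 2 (1 + sqrt theta)^2 k / theta, which is the claimed constant. *)
Require Import Defs.
From HB Require Import structures.
From mathcomp Require Import all_boot all_order all_algebra.
From mathcomp Require Import all_classical all_reals all_analysis.
From mathcomp Require Import zify ring lra.
Import Order.TTheory GRing.Theory Num.Theory.
Import numFieldNormedType.Exports.
Set Implicit Arguments.
Unset Strict Implicit.
Unset Printing Implicit Defensive.

(** The pools are fixed in advance but the decoding is sequential: each score uses residuals that
    depend on all earlier decisions. To avoid conditioning on the past, the score is replaced by
    [accepts], defined from the design and the true labelling as if every earlier decision had been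
    right. If all these verdicts are correct, induction along the decoding order shows that the run
    reproduces them, so a plain union bound over the verdicts suffices.

    All sizes are tied to B = [mean_load], about (ln n)^2. With S = k / B^2 there are about S B
    compartments of load about B, and S further positions behind the last one. This lookahead is
    only a fraction 1 / B of the positions, yet S is n^(theta - o(1)), so even the last compartment
    sees a harmonic sum of about theta ln n: this is the source of the factor theta. With T about C1
    B the number of pools is about C1 k.

    The machine knows only natural numbers, hence the rational threshold a / b, the integer weights
    n %/ l, and scores kept as a positive and a negative sum. *)

Local Notation Sub := Defs.Sub.
Local Notation eval := Defs.eval.

(** * Bounded loop programs *)

(* The bound of a loop is the first or second input parameter, n or m. *)
Inductive prog : Type :=
| PSkip
| PSet of nat & expr & expr
| PSeq of prog & prog
| PIf of expr & prog & prog
| PFor of nat & bool & prog.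

Definition var (a : nat) : expr := Get a (Const 0).

Fixpoint compile (c : prog) : cmd :=
  match c with
  | PSkip => Skip
  | PSet a i e => Assign a i e
  | PSeq c1 c2 => Seq (compile c1) (compile c2)
  | PIf e c1 c2 => If e (compile c1) (compile c2)
  | PFor v b c1 =>
      Seq (Assign v (Const 0) (Const 0))
        (While (Sub (Get 0 (Const b)) (var v))
           (Seq (compile c1) (Assign v (Const 0) (Add (var v) (Const 1)))))
  end.

Fixpoint den (c : prog) (s : memory) : memory :=
  match c with
  | PSkip => s
  | PSet a i e => update s a (eval s i) (eval s e)
  | PSeq c1 c2 => den c2 (den c1 s)
  | PIf e c1 c2 => if eval s e != 0 then den c1 s else den c2 s
  | PFor v b c1 =>
      iteri (s 0 b) (fun i s' => update (den c1 s') v 0 i.+1) (update s v 0 0)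
  end.

Fixpoint writes (c : prog) : seq nat :=
  match c with
  | PSkip => [::]
  | PSet a _ _ => [:: a]
  | PSeq c1 c2 => writes c1 ++ writes c2
  | PIf _ c1 c2 => writes c1 ++ writes c2
  | PFor v _ c1 => v :: writes c1
  end.

(** Array 0 holds the loop bounds and must stay intact; a counter untouched by its body makes the
    number of rounds the bound read at entry, as [iteri] in [den] assumes. *)
Fixpoint loops_ok (c : prog) : bool :=
  match c with
  | PSkip | PSet _ _ _ => true
  | PSeq c1 c2 | PIf _ c1 c2 => loops_ok c1 && loops_ok c2
  | PFor v _ c1 => [&& 0 \notin v :: writes c1, v \notin writes c1 & loops_ok c1]
  end.

(** ['X] stands for a common bound on n and m. The inner 2 pays for the test and the increment of
    one round, the outer 2 for the initial assignment and the final failing test. *)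
Fixpoint cost (c : prog) : {poly nat} :=
  (match c with
  | PSkip | PSet _ _ _ => 1
  | PSeq c1 c2 => cost c1 + cost c2
  | PIf _ c1 c2 => cost c1 + cost c2 + 1
  | PFor _ _ c1 => 'X * (cost c1 + 2%N%:P) + 2%N%:P
  end)%R.

Lemma updateE s a i v b j :
  update s a i v b j = if (b == a) && (j == i) then v else s b j.
Proof. by []. Qed.

Lemma den_frame c s a j : a \notin writes c -> den c s a j = s a j.
Proof.
elim: c s => [|b i e|c1 IH1 c2 IH2|e c1 IH1 c2 IH2|v b c IH] s //=.
- by rewrite inE updateE => /negbTE ->.
- by rewrite mem_cat negb_or => /andP[h1 h2]; rewrite IH2 // IH1.
- by rewrite mem_cat negb_or => /andP[h1 h2]; case: ifP => _; [rewrite IH1|rewrite IH2].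
- rewrite inE negb_or => /andP[/negbTE av ac].
  elim: (s 0 b) => [|N IHN] /=; first by rewrite updateE av.
  by rewrite updateE av /= IH.
Qed.

Lemma exec_compile c s M : loops_ok c -> s 0 0 <= M -> s 0 1 <= M ->
  0 \notin writes c ->
  exists2 t, exec (compile c) s t (den c s) & t <= (cost c).[M]%R.
Proof.
elim: c s => [|b i e|c1 IH1 c2 IH2|e c1 IH1 c2 IH2|v b c IH] s /=.
- by exists 1; [exact: ExecSkip|rewrite hornerC].
- by exists 1; [exact: ExecAssign|rewrite hornerC].
- rewrite mem_cat negb_or => /andP[k1 k2] sn sm /andP[w1 w2].
  have [t1 e1 l1] := IH1 s k1 sn sm w1.
  have [| |t2 e2 l2] := IH2 (den c1 s) k2 _ _ w2; rewrite ?den_frame //.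
  by exists (t1 + t2); [exact: ExecSeq e1 e2|rewrite hornerD; exact: leq_add].
- rewrite mem_cat negb_or => /andP[k1 k2] sn sm /andP[w1 w2].
  rewrite !hornerD hornerC.
  have [t1 e1 l1] := IH1 s k1 sn sm w1; have [t2 e2 l2] := IH2 s k2 sn sm w2.
  case: ifPn => [he|/negPn/eqP he].
  + exists t1.+1; first exact: ExecIfTrue.
    by rewrite -addn1; apply: leq_add => //; apply: leq_trans l1 (leq_addr _ _).
  + exists t2.+1; first exact: ExecIfFalse.
    by rewrite -addn1; apply: leq_add => //; apply: leq_trans l2 (leq_addl _ _).
- move=> /and3P[w0 vc kc] sn sm _.
  have sb : s 0 b <= M by case: b.
  have [v0 c0] : 0 != v /\ 0 \notin writes c.
    by move: w0; rewrite inE negb_or => /andP.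
  pose F i s' := update (den c s') v 0 i.+1.
  pose st i := iteri i F (update s v 0 0).
  have st0 i x : st i 0 x = s 0 x.
    elim: i => [|i IHi] /=; first by rewrite updateE (negbTE v0).
    by rewrite /F updateE (negbTE v0) /= den_frame.
  have stv i : st i v 0 = i.
    by case: i => [|i] /=; rewrite ?/F updateE !eqxx.
  (* Induction on the number [k] of rounds still to come, because the rule for a successful test
     peels off the first round. *)
  have main k : k <= s 0 b -> exists2 t,
    exec (While (Sub (Get 0 (Const b)) (var v))
           (Seq (compile c) (Assign v (Const 0) (Add (var v) (Const 1)))))
       (st (s 0 b - k)) t (st (s 0 b))
    & t <= k * ((cost c).[M]%R + 2) + 1.
    elim: k => [|k IHk] hk.
      rewrite subn0; exists 1 => //; apply: ExecWhileFalse => /=.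
      by rewrite stv st0 subnn.
    have [t2 e2 l2] := IHk (ltnW hk).
    have [| |t1 e1 l1] := IH (st (s 0 b - k.+1)) kc _ _ c0; rewrite ?st0 //.
    exists (t1 + 1 + t2).+1.
      apply: ExecWhileTrue e2.
        by rewrite /= stv st0 subKn.
      apply: ExecSeq e1 _.
      have -> : s 0 b - k = (s 0 b - k.+1).+1 by rewrite subnSK.
      have -> : st (s 0 b - k.+1).+1 = update (den c (st (s 0 b - k.+1))) v
         (eval (den c (st (s 0 b - k.+1))) (Const 0))
         (eval (den c (st (s 0 b - k.+1))) (Add (var v) (Const 1))).
        by rewrite /= den_frame // stv addn1.
      exact: ExecAssign.
    rewrite mulSn; lia.
  have [t e l] := main _ (leqnn _).
  exists (1 + t).
    by apply: ExecSeq (ExecAssign _ _ _ _) _; rewrite subnn in e.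
  rewrite hornerD hornerM hornerX hornerD !hornerC.
  apply: leq_trans (leq_add (leqnn 1) l) _.
  have : s 0 b * ((cost c).[M]%R + 2) <= M * ((cost c).[M]%R + 2) by exact: leq_mul.
  by move=> h; rewrite addnCA (leq_add h).
Qed.

(** Invariant rule for loops. The invariant has to ignore the counter, which the loop overwrites
    around each run of the body; in exchange the step may use that arrays not written by the loop
    keep their initial contents. *)
Lemma den_for (I : nat -> memory -> Prop) v b c s :
  loops_ok (PFor v b c) ->
  (forall i s' x, I i s' -> I i (update s' v 0 x)) ->
  I 0 s ->
  (forall i s', i < s 0 b ->
     (forall a j, a \notin v :: writes c -> s' a j = s a j) ->
     s' v 0 = i -> I i s' -> I i.+1 (den c s')) ->
  I (s 0 b) (den (PFor v b c) s).
Proof.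
move=> /= /and3P[w0 vc kc] Iv I0 IS.
have H : forall k, k <= s 0 b ->
  let s' := iteri k (fun i s' => update (den c s') v 0 i.+1) (update s v 0 0) in
  [/\ I k s', forall a j, a \notin v :: writes c -> s' a j = s a j & s' v 0 = k].
  elim=> [|k IHk] hk /=.
    split; [exact: Iv| |by rewrite updateE !eqxx].
    by move=> a j; rewrite inE negb_or => /andP[/negbTE av _]; rewrite updateE av.
  have [h1 h2 h3] := IHk (ltnW hk).
  split; [exact/Iv/IS| |by rewrite updateE !eqxx].
  move=> a j aw; have := aw; rewrite inE negb_or => /andP[/negbTE av ac].
  by rewrite updateE av /= den_frame // h2.
by have [] := H _ (leqnn _).
Qed.

(* Guarantees that the result is a labelling even on inputs that are not
   measurements of anything. *)
Fixpoint bounded_output (a d : nat) (c : prog) : bool :=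
  match c with
  | PSkip => true
  | PSet b _ e => (b == a) ==> (if e is Const w then w <= d else false)
  | PSeq c1 c2 | PIf _ c1 c2 => bounded_output a d c1 && bounded_output a d c2
  | PFor v _ c1 => (v != a) && bounded_output a d c1
  end.

Lemma den_bounded a d c s : bounded_output a d c ->
  (forall j, s a j <= d) -> forall j, den c s a j <= d.
Proof.
elim: c s => [|b i e|c1 IH1 c2 IH2|e c1 IH1 c2 IH2|v b c IH] s //=.
- move=> he hs j; rewrite updateE; case: ifP => // /andP[/eqP ab _].
  by move: he; rewrite ab eqxx; case: e.
- by move=> /andP[h1 h2] hs; apply: IH2 => //; apply: IH1.
- by move=> /andP[h1 h2] hs; case: ifP => _; [apply: IH1|apply: IH2].
- move=> /andP[va h] hs; elim: (s 0 b) => [|N IHN] j /=.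
    by rewrite updateE eq_sym (negbTE va) /=.
  by rewrite updateE eq_sym (negbTE va) /=; apply: IH.
Qed.

(** * The decoder *)

(** The machine cannot multiply; products with the literals 2, [a], [b] and [d.+1] are unrolled into
    sums. *)
Fixpoint mulc (b : nat) (e : expr) : expr :=
  if b is b'.+1 then Add e (mulc b' e) else Const 0.

Lemma eval_mulc s b e : eval s (mulc b e) = b * eval s e.
Proof. by elim: b => //= b ->; rewrite mulSn. Qed.

Fixpoint reads (e : expr) : seq nat :=
  match e with
  | Const _ => [::]
  | Get a e1 => a :: reads e1
  | Add e1 e2 | Sub e1 e2 => reads e1 ++ reads e2
  end.

Lemma reads_mulc b e a : a \notin reads e -> a \notin reads (mulc b e).
Proof. by move=> h; elim: b => //= b IH; rewrite mem_cat negb_or h. Qed.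

Lemma eval_eq s s' e : (forall a j, a \in reads e -> s a j = s' a j) ->
  eval s e = eval s' e.
Proof.
elim: e => //= [a e IH|e1 IH1 e2 IH2|e1 IH1 e2 IH2] h.
- rewrite h ?inE ?eqxx // IH // => b j hb; apply: h; by rewrite inE hb orbT.
- by rewrite IH1 ?IH2 // => b j hb; apply: h; rewrite mem_cat hb ?orbT.
- by rewrite IH1 ?IH2 // => b j hb; apply: h; rewrite mem_cat hb ?orbT.
Qed.

Lemma eval_update s a i v e : a \notin reads e ->
  eval (update s a i v) e = eval s e.
Proof.
move=> h; apply: eval_eq => b j hb; rewrite updateE.
by case: eqP => // ba; rewrite -ba hb in h.
Qed.

Section Decoder.

(* Arrays 0 to 3 are those of the input and output conventions.  The variables
   below live in cell 0 of their own arrays, except for the tables [row]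
   (j * n, the offset of pool j in the biadjacency matrix) and [typ], [pos]
   (remainder and quotient of j by T + 1). *)
Local Notation inc := 1.
Local Notation res := 2.
Local Notation out := 3.
Local Notation tee := 4.
Local Notation row := 5.
Local Notation typ := 6.
Local Notation pos := 7.
Local Notation item := 8.
Local Notation pool := 9.
Local Notation comp := 10.
Local Notation rep := 11.
Local Notation cnt := 12.
Local Notation sgp := 13.
Local Notation sgm := 14.
Local Notation wei := 15.
Local Notation acc := 16.

Definition incr (a : nat) (e : expr) : prog :=
  PSet a (Const 0) (Add (var a) e).
Definition reset (a : nat) : prog := PSet a (Const 0) (Const 0).

Definition incidence (v : nat) : expr := Get inc (Add (Get row (var v)) (var item)).
Definition result_addr (d w v : nat) : expr := Add (mulc d.+1 (var v)) (Const w).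
Definition result (d w v : nat) : expr := Get res (result_addr d w v).
(** The l of the weight 1/l, the item's own position counting as 1. Truncated subtraction makes it 0
    exactly for pools at earlier positions, so it also serves as the test in [score_step]. *)
Definition lag : expr := Sub (Add (Get pos (var pool)) (Const 1)) (Get pos (var comp)).

Lemma den_seq c1 c2 s : den (PSeq c1 c2) s = den c2 (den c1 s).
Proof. by []. Qed.

Lemma den_if e c1 c2 s :
  den (PIf e c1 c2) s = if eval s e != 0 then den c1 s else den c2 s.
Proof. by []. Qed.

Lemma den_incr a e s : den (incr a e) s = update s a 0 (s a 0 + eval s e).
Proof. by []. Qed.

Lemma eval_result s d w v : eval s (result d w v) = s res (d.+1 * s v 0 + w).
Proof. by rewrite /result [LHS]/= -[X in X + w]/(eval s (mulc d.+1 (var v))) eval_mulc. Qed.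

(* Only the first n %/ lag of the n rounds take effect; this multiplies by the
   weight n %/ lag. *)
Definition add_round (d w : nat) : prog :=
  PSeq (incr acc lag)
    (PIf (Sub (Add (Get 0 (Const 0)) (Const 1)) (var acc))
      (PSeq (incr wei (Const 1))
        (PIf (incidence pool)
          (PSeq (incr sgp (mulc 2 (result d w pool))) (incr sgm (var cnt)))
          (PSeq (incr sgp (var cnt)) (incr sgm (mulc 2 (result d w pool))))))
      PSkip).

Definition add_test (d w : nat) : prog :=
  PSeq (reset acc) (PFor rep false (add_round d w)).

(** Each position starts with its counting pool. Hence, as long as the decisions so far are right,
    [cnt] gives at a random pool the number of undecoded items of label [w] in all compartments that
    this pool can meet. *)
Definition score_step (d w : nat) : prog :=
  PIf lag
    (PIf (Get typ (var pool)) (add_test d w) (incr cnt (result d w pool)))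
    PSkip.

Definition score (d w : nat) : prog :=
  PSeq (PSeq (reset cnt) (PSeq (reset sgp) (PSeq (reset sgm) (reset wei))))
    (PFor pool true (score_step d w)).

Definition subtract (d w : nat) : prog :=
  PSet res (result_addr d w pool) (Sub (result d w pool) (incidence pool)).

Definition classify (a b d w : nat) : prog :=
  PSeq (score d w)
    (PIf (Sub (mulc b (var sgp)) (Add (mulc b (var sgm)) (mulc a (var wei))))
      (PSeq (PSet out (var item) (Const w)) (PFor pool true (subtract d w)))
      PSkip).

Definition classify_all (a b d : nat) (ws : seq nat) : prog :=
  foldr (fun w => PSeq (classify a b d w)) PSkip ws.

Arguments classify_all : simpl never.
Arguments mulc : simpl never.

Definition read_tee : prog :=
  PFor item false (incr tee (Get inc (var item))).

(** Division by T + 1 is replaced by a running remainder and quotient. Round j fills entry j + 1;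
    entry 0 is right because these arrays start at zero. *)
Definition tabulate_step : prog :=
  PSeq (PSet row (Add (var pool) (Const 1)) (Add (Get row (var pool)) (Get 0 (Const 0))))
    (PIf (Sub (var tee) (Get typ (var pool)))
      (PSeq
        (PSet typ (Add (var pool) (Const 1)) (Add (Get typ (var pool)) (Const 1)))
        (PSet pos (Add (var pool) (Const 1)) (Get pos (var pool))))
      (PSeq
        (PSet typ (Add (var pool) (Const 1)) (Const 0))
        (PSet pos (Add (var pool) (Const 1)) (Add (Get pos (var pool)) (Const 1))))).

Definition tabulate : prog := PFor pool true tabulate_step.

Definition decode_item (a b d : nat) : prog :=
  PIf (incidence comp) (classify_all a b d (iota 1 d)) PSkip.

Definition decode_pool (a b d : nat) : prog :=
  PIf (Get pos (var comp))
    (PIf (Get typ (var comp)) PSkip (PFor item false (decode_item a b d)))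
    PSkip.

Definition decode_pools (a b d : nat) : prog := PFor comp true (decode_pool a b d).

Definition decoder (a b d : nat) : prog :=
  PSeq read_tee (PSeq tabulate (decode_pools a b d)).

(** The written arrays do not depend on the label, so label 0 represents all labels and frame
    conditions for an unknown [d] reduce to a computation. *)
Lemma classify_all_writes a b d ws x : x \in writes (classify_all a b d ws) ->
  x \in writes (classify a b d 0).
Proof.
elim: ws => [|w ws IH] //.
change (x \in writes (classify a b d w) ++ writes (classify_all a b d ws) ->
  x \in writes (classify a b d w)).
by rewrite mem_cat => /orP[|/IH].
Qed.

Lemma loops_ok_decoder a b d : loops_ok (decoder a b d) /\ 0 \notin writes (decoder a b d).
Proof.
have H x : x \notin writes (classify a b d 0) ->
    (x \in writes (classify_all a b d (iota 1 d))) = false.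
  by move=> h; apply/negP => /classify_all_writes; apply/negP.
have Hs ws : loops_ok (classify_all a b d ws).
  by elim: ws => // w ws IH; apply/andP; split.
by rewrite /= Hs !inE !mem_cat !inE !H.
Qed.

Lemma bounded_decoder a b d : bounded_output out d (decoder a b d).
Proof.
have H ws : all (leq^~ d) ws -> bounded_output out d (classify_all a b d ws).
  elim: ws => // w ws IH /andP[wd /IH h].
  by apply/andP; split => //; rewrite /= andbT wd.
rewrite /= H //; apply/allP => w; rewrite mem_iota; lia.
Qed.

Lemma reads_result d w v a :
  a \notin [:: res; v] -> a \notin reads (result d w v).
Proof.
move=> h; change (a \notin res :: (reads (mulc d.+1 (var v)) ++ [::])).
have /andP[ar av] : (a != res) && (a != v) by rewrite !inE negb_or in h.
rewrite cats0 in_cons negb_or ar andTb.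
by apply: reads_mulc; rewrite inE.
Qed.

Lemma den_add_test d w s : 0 < eval s lag ->
  let q := s 0 0 %/ eval s lag in
  let r := eval s (result d w pool) in
  let inci := eval s (incidence pool) != 0 in
  let s' := den (add_test d w) s in
  [/\ s' wei 0 = s wei 0 + q,
      s' sgp 0 = s sgp 0 + q * (if inci then 2 * r else s cnt 0)
    & s' sgm 0 = s sgm 0 + q * (if inci then s cnt 0 else 2 * r)].
Proof.
move=> l0 q r inci s'.
set p1 := if inci then 2 * r else s cnt 0.
set p2 := if inci then s cnt 0 else 2 * r.
pose s0 := den (reset acc) s.
pose I u (z : memory) := [/\ z acc 0 = u * eval s lag,
  z wei 0 = s wei 0 + minn u q, z sgp 0 = s sgp 0 + minn u q * p1
  & z sgm 0 = s sgm 0 + minn u q * p2].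
have : I (s0 0 false) s'.
  change s' with (den (PFor rep false (add_round d w)) s0).
  apply: (@den_for I) => //.
    by rewrite /I /= min0n !mul0n !addn0.
  move=> u z un fr zu [zacc zw zp zm].
  have e_lag : eval z lag = eval s lag by rewrite /= !fr.
  have e_inc : eval z (incidence pool) != 0 = inci by rewrite /inci /= !fr.
  have e_res : eval z (result d w pool) = r by rewrite /r !eval_result !fr.
  have e_cnt : z cnt 0 = s cnt 0 by rewrite fr.
  have e_n : z 0 0 = s 0 0 by rewrite fr.
  rewrite /add_round den_seq den_incr e_lag zacc addnC -mulSn.
  set z1 := update z acc 0 _.
  (* The accumulator now holds u + 1 times the lag, so the test asks whether this is at most n, that
     is, whether u < n %/ lag. *)
  have e_test : (eval z1 (Sub (Add (Get 0 (Const 0)) (Const 1)) (var acc)) != 0) = (u < q).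
    by rewrite /q leq_divRL // /z1; move: (eval s lag) => l; rewrite /= !updateE /= e_n; lia.
  rewrite den_if e_test; case: ltnP => uq; last first.
    have [h1 h2] : minn u.+1 q = minn u q /\ minn u q = q by lia.
    by rewrite /I h1; split.
  have [h1 h2] : minn u.+1 q = u.+1 /\ minn u q = u by lia.
  rewrite h2 in zw zp zm.
  rewrite den_seq den_incr den_if !eval_update // e_inc /I h1.
  have eqr x : x \notin reads (mulc 2 (result d w pool)) ->
      forall y a i, eval (update y x i a) (mulc 2 (result d w pool)) =
        eval y (mulc 2 (result d w pool)).
    by move=> hx y a i; rewrite eval_update.
  have nr x : x \notin [:: res; pool] -> x \notin reads (mulc 2 (result d w pool)).
    by move=> hx; apply/reads_mulc/reads_result.
  rewrite /p1 /p2 in zp zm *.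
  case: (inci) zp zm => zp zm; rewrite den_seq !den_incr !eqr ?nr // eval_mulc e_res;
    rewrite /z1 /= !updateE /= e_cnt zw zp zm; split => //; lia.
rewrite /I => -[_ -> -> ->].
have -> : s0 0 false = s 0 0 by [].
by rewrite (minn_idPr (leq_div _ _)).
Qed.

Definition residual (d w : nat) (s : memory) (j : nat) : nat := s res (d.+1 * j + w).

Definition member (s : memory) (j : nat) : bool := s inc (s row j + s item 0) != 0.

Definition relevant (s : memory) (j : nat) : bool := s pos (s comp 0) <= s pos j.

Definition weight (s : memory) (j : nat) : nat :=
  if relevant s j && (s typ j != 0)
  then s 0 0 %/ ((s pos j).+1 - s pos (s comp 0)) else 0.

Definition unknown (d w : nat) (s : memory) (j : nat) : nat :=
  \sum_(j' < j) if relevant s j' && (s typ j' == 0) then residual d w s j' else 0.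

(** Twice the residual minus the number of unknown items is the centred residual, a sum of signs. It
    is negated for pools that avoid the item, and truncated subtraction forces its two summands into
    separate sums. *)
Definition positive_part (d w : nat) (s : memory) (j : nat) : nat :=
  weight s j * if member s j then 2 * residual d w s j else unknown d w s j.

Definition negative_part (d w : nat) (s : memory) (j : nat) : nat :=
  weight s j * if member s j then unknown d w s j else 2 * residual d w s j.

Lemma den_score d w s : let s' := den (score d w) s in
  [/\ s' sgp 0 = \sum_(j < s 0 1) positive_part d w s j,
      s' sgm 0 = \sum_(j < s 0 1) negative_part d w s j
    & s' wei 0 = \sum_(j < s 0 1) weight s j].
Proof.
set init := PSeq (reset cnt) (PSeq (reset sgp) (PSeq (reset sgm) (reset wei))).
pose s0 := den init s => s'.
pose I i (z : memory) := [/\ z sgp 0 = \sum_(j < i) positive_part d w s j,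
      z sgm 0 = \sum_(j < i) negative_part d w s j,
      z wei 0 = \sum_(j < i) weight s j & z cnt 0 = unknown d w s i].
suff : I (s0 0 true) s' by case.
change s' with (den (PFor pool true (score_step d w)) s0).
apply: (@den_for I) => //.
  by rewrite /I /unknown !big_ord0.
move=> i z im fr zi [zp zm zw zc].
have frs a j : a \notin [:: cnt; sgp; sgm; wei; pool; acc; rep] -> z a j = s a j.
  rewrite !inE !negb_or => /and5P[h1 h2 h3 h4 /and3P[h5 h6 h7]].
  rewrite fr; last by rewrite /= !inE !negb_or h1 h2 h3 h4 h5 h6 h7.
  by rewrite /s0 /= !updateE (negbTE h1) (negbTE h2) (negbTE h3) (negbTE h4).
have e_lag : eval z lag = (s pos i).+1 - s pos (s comp 0).
  by rewrite /= zi !frs // addn1.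
have e_res : eval z (result d w pool) = residual d w s i.
  by rewrite eval_result zi frs.
have e_inc : (eval z (incidence pool) != 0) = member s i.
  by rewrite /member /= zi !frs.
have e_rel : (eval z lag != 0) = relevant s i.
  by rewrite e_lag /relevant; lia.
have e_typ : eval z (Get typ (var pool)) = s typ i by rewrite /= zi frs.
have unkS : unknown d w s i.+1 = unknown d w s i +
   (if relevant s i && (s typ i == 0) then residual d w s i else 0).
  by rewrite /unknown big_ord_recr.
rewrite /score_step den_if e_rel den_if e_typ den_incr e_res zc.
have [wE pE mE] : [/\ weight s i = if relevant s i && (s typ i != 0) then
  s 0 0 %/ ((s pos i).+1 - s pos (s comp 0)) else 0,
   positive_part d w s i = weight s i * (if member s i then 2 * residual d w s i else unknown d w s i)
  & negative_part d w s i = weight s i * (if member s i then unknown d w s i else 2 * residual d w s i)] by [].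
have bS (F : nat -> nat) : \sum_(j < i.+1) F j = \sum_(j < i) F (nat_of_ord j) + F i by rewrite big_ord_recr.
rewrite /I !bS unkS pE mE wE.
case: (relevant s i) e_rel => e_rel; last by rewrite !andFb !mul0n !addn0.
rewrite !andTb.
case: (eqVneq (s typ i) 0) => ti.
  by rewrite [~~ true]/= !mul0n !addn0 !updateE. 

have l0 : 0 < eval z lag by rewrite lt0n e_rel.
cbn [negb]; have [-> -> ->] := den_add_test d w l0.
rewrite e_res e_inc e_lag (frs 0) ?addn0 // zp zm zw zc.
by split => //; rewrite ?den_frame // ?zc //.
Qed.

Lemma den_classify a b d w s x : w <= d ->
  let s' := den (classify a b d w) s in
  let dec := a * \sum_(j < s 0 1) weight s j + b * \sum_(j < s 0 1) negative_part d w s j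
    < b * \sum_(j < s 0 1) positive_part d w s j in
  s' out x = (if dec && (x == s item 0) then w else s out x) /\
  forall j w', w' <= d -> s' res (d.+1 * j + w') =
    if [&& dec, j < s 0 1 & w' == w]
    then residual d w s j - s inc (s row j + s item 0) else residual d w' s j.
Proof.
move=> wd s' dec.
have [pE mE wE] := den_score d w s.
set s0 := den (score d w) s in pE mE wE *.
have fr a' j : a' \notin [:: cnt; sgp; sgm; wei; pool; acc; rep] -> s0 a' j = s a' j.
  rewrite !inE !negb_or => /and5P[h1 h2 h3 h4 /and3P[h5 h6 h7]].
  by rewrite /s0 den_frame // /= !inE !negb_or h1 h2 h3 h4 h5 h6 h7.
have -> : s' = if dec then den (PFor pool true (subtract d w)) (update s0 out (s0 item 0) w)
    else s0.
  rewrite /s' /classify den_seq den_if -/s0.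
  have -> : (eval s0 (Sub (mulc b (var sgp)) (Add (mulc b (var sgm)) (mulc a (var wei)))) != 0)
    = dec.
    have -> : eval s0 (Sub (mulc b (var sgp)) (Add (mulc b (var sgm)) (mulc a (var wei)))) =
      b * s0 sgp 0 - (b * s0 sgm 0 + a * s0 wei 0).
      by rewrite -[LHS]/(eval s0 (mulc b (var sgp)) - (eval s0 (mulc b (var sgm))
        + eval s0 (mulc a (var wei)))) !eval_mulc.
    by rewrite pE mE wE /dec; lia.
  by case: ifP.
case: dec; last first.
  by split=> [|j w' _]; rewrite fr.
set s1 := update s0 out _ w.
split.
  rewrite den_frame // /s1 updateE /= !fr //.
pose I i (z : memory) := forall j w', w' <= d -> z res (d.+1 * j + w') =
   if (j < i) && (w' == w) then residual d w s j - s inc (s row j + s item 0)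
   else residual d w' s j.
suff H : I (s1 0 true) (den (PFor pool true (subtract d w)) s1).
  move=> j w' w'd; rewrite H //.
  by have -> : s1 0 true = s 0 1 by rewrite /s1 updateE /= fr.
apply: (@den_for I) => //.
  by move=> j w' w'd /=; rewrite /s1 updateE /= fr.
move=> i z im frz zi zI j w' w'd.
have frs a' j' : a' \notin [:: cnt; sgp; sgm; wei; pool; acc; rep; out; res] -> z a' j' = s a' j'.
  rewrite !inE !negb_or => /and5P[h1 h2 h3 h4 /and5P[h5 h6 h7 h8 h9]].
  rewrite frz; last by rewrite /= !inE !negb_or h5 h9.
  by rewrite /s1 updateE (negbTE h8) /= fr // !inE !negb_or h1 h2 h3 h4 h5 h6 h7.
rewrite [den _ _]/(update z res (eval z (result_addr d w pool))
  (eval z (result d w pool) - eval z (incidence pool))).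
have -> : eval z (result_addr d w pool) = d.+1 * i + w.
  by rewrite -[LHS]/(eval z (mulc d.+1 (var pool)) + w) eval_mulc /= zi.
have -> : eval z (incidence pool) = s inc (s row i + s item 0).
  by rewrite /= zi !frs.
rewrite eqxx andTb eval_result zi !zI // ltnn /=.
(* Quotient and remainder by d + 1 recover pool and label from an address, as both labels are at
   most d. *)
have -> : (d.+1 * j + w' == d.+1 * i + w) = (j == i) && (w' == w).
  apply/eqP/andP => [h|[/eqP -> /eqP ->]] //.
  have := congr1 (modn^~ d.+1) h; have := congr1 (divn^~ d.+1) h.
  rewrite /= ![d.+1 * _]mulnC !divnMDl // !modnMDl !divn_small // !modn_small //.
  by rewrite !addn0 => -> ->; rewrite !eqxx.
rewrite ltnS [j <= i]leq_eqVlt.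
by case: (eqVneq j i) => [->|_] //=; case: eqP => // _; rewrite ltnn.
Qed.

(** * Correctness of the decoder for a fixed design and ground truth *)

Section Decoding.
Variables (n m d T a b : nat) (G : design n m) (sigma : labelling n d).
Variable cp : 'I_n -> nat.

(** The structural properties on which decoding relies, separated from the randomness so that only
    the verdicts [accepts] are left to probability. *)
Definition layout : Prop :=
  [/\ forall x, 0 < cp x, forall x, cp x * T.+1 < m,
      forall j : 'I_m, (j : nat) = 0 -> #|G j| = T,
      forall (j : 'I_m) x, 0 < j -> j %% T.+1 = 0 ->
        (x \in G j) = (cp x == j %/ T.+1)
    & forall (j : 'I_m) x, j %% T.+1 != 0 -> x \in G j -> cp x <= j %/ T.+1].

(** The true carriers of [w] still undecoded when [i] is considered, [i] included: the decoding
    order is by compartment, then by index. *)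
Definition remaining (i : 'I_n) (w : nat) : {set 'I_n} :=
  [set x | (sigma x == w :> nat) && ((cp i < cp x) || (cp i == cp x) && (i <= x))].

Definition test_weight (i : 'I_n) (j : nat) : nat :=
  if (cp i <= j %/ T.+1) && (j %% T.+1 != 0)
  then n %/ ((j %/ T.+1).+1 - cp i) else 0.

Definition hits (i : 'I_n) (w : nat) (j : 'I_m) : nat := #|G j :&: remaining i w|.

Definition window (i : 'I_n) (w : nat) (j : 'I_m) : nat :=
  #|[set x in remaining i w | cp x <= j %/ T.+1]|.

(** The test of [classify] with the machine state replaced by ideal residuals. The factor [b] clears
    the denominator of the threshold a / b, and negative terms are moved to the left to avoid
    subtraction. *)
Definition accepts (i : 'I_n) (w : nat) : bool :=
  a * \sum_(j < m) test_weight i j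
  + b * \sum_(j < m) test_weight i j *
          (if i \in G j then window i w j else 2 * hits i w j)
  < b * \sum_(j < m) test_weight i j *
          (if i \in G j then 2 * hits i w j else window i w j).

Definition tables (s : memory) : Prop :=
  [/\ s 0 0 = n, s 0 1 = m,
      forall (j : 'I_m) (x : 'I_n), s inc (j * n + x) = (x \in G j)
    & forall j, j < m ->
        [/\ s row j = j * n, s typ j = j %% T.+1 & s pos j = j %/ T.+1]].

Lemma tables_eq s s' :
  (forall x j, x \in [:: 0; inc; row; typ; pos] -> s' x j = s x j) ->
  tables s -> tables s'.
Proof.
move=> fr [h1 h2 h3 h4]; split; rewrite ?fr //.
- by move=> j x; rewrite fr.
- by move=> j jm; rewrite !fr //; exact: h4.
Qed.

(** [c] and [i] are the counters of the two nested loops; [x] is handled when the outer one reaches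
    the counting pool [cp x * T.+1]. *)
Definition decoded (c i : nat) (x : 'I_n) : bool :=
  (cp x * T.+1 < c) || ((cp x * T.+1 == c) && (x < i)).

Definition partial_state (c i w : nat) (s : memory) : Prop :=
  (forall x : 'I_n, s out x =
     if decoded c i x || ((x == i :> nat) && (0 < sigma x < w)) then sigma x : nat else 0)
  /\ forall (j : 'I_m) w', 0 < w' <= d -> s res (d.+1 * j + w') =
     #|[set x in G j | [&& sigma x == w' :> nat, ~~ decoded c i x
                         & ~~ ((x == i :> nat) && (w' < w))]]|.

Hypothesis layoutP : layout.
Hypothesis acceptsP : forall (i : 'I_n) w, 0 < w <= d -> accepts i w = (sigma i == w :> nat).

(** Double counting: each remaining item whose compartment is at most the position of [j] lies in
    exactly one relevant counting pool before [j], namely pool [cp x * T.+1]. *)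
Lemma unknown_window s (i : 'I_n) w (j : 'I_m) : tables s ->
  s comp 0 = cp i * T.+1 -> s item 0 = i ->
  (forall j : 'I_m, residual d w s j = hits i w j) ->
  cp i <= j %/ T.+1 -> j %% T.+1 != 0 ->
  unknown d w s j = window i w j.
Proof.
move=> [sn sm sinc stab] sc si sr cj tj.
have [cp0 cpm _ Gc _] := layoutP.
have pc : s pos (s comp 0) = cp i.
  by rewrite sc; have [_ _ ->] := stab _ (cpm i); rewrite mulnK.
rewrite /unknown.
have E (l : 'I_j) : (if relevant s l && (s typ l == 0) then residual d w s l else 0) =
    \sum_(x in [set x in remaining i w | cp x <= j %/ T.+1]) (cp x * T.+1 == l).
  have lm : l < m := ltn_trans (ltn_ord l) (ltn_ord j).
  pose l' := Ordinal lm.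
  have [_ ty po] := stab _ lm; rewrite /relevant pc ty po.
  case: ifPn => [/andP[cl /eqP tl]|].
    have -> : residual d w s l = hits i w l' by rewrite -sr.
    rewrite /hits -sum1_card big_mkcond [RHS]big_mkcond /=; apply: eq_bigr => x _.
    have l0 : 0 < l'.
      by have := cp0 i; rewrite /=; case: (nat_of_ord l) cl => //; rewrite div0n; lia.
    rewrite !inE Gc //.
    have lE := divn_eq l T.+1; rewrite tl addn0 in lE.
    have -> : (cp x * T.+1 == l) = (cp x == l' %/ T.+1).
      by rewrite {1}lE eqn_mul2r /=.
    case: eqP => [->|_]; last by rewrite andFb [LHS]/=; case: ifP.
    have -> : l' %/ T.+1 <= j %/ T.+1 by apply/leq_div2r/ltnW/(ltn_ord l).
    by rewrite andbT; case: ifP.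
  move=> H; rewrite big1 // => x; rewrite !inE => /andP[/andP[_ h] _].
  apply/eqP; rewrite eqb0; apply: contra H => /eqP <-.
  by rewrite mulnK // modnMl eqxx andbT; lia.
rewrite (eq_bigr _ (fun l _ => E l)) exchange_big /=.
rewrite /window -sum1_card; apply: eq_bigr => x; rewrite inE => /andP[_ cx].
(* Strict because [j] is not a counting pool. *)
have xj : cp x * T.+1 < j.
  rewrite (divn_eq j T.+1); have : cp x * T.+1 <= j %/ T.+1 * T.+1 by rewrite leq_mul2r cx orbT.
  lia.
rewrite (bigD1 (Ordinal xj)) //= eqxx big1 // => l /eqP lx.
by case: eqP => // h; case: lx; apply: val_inj.
Qed.

Lemma sums_accepts s (i : 'I_n) w : tables s ->
  s comp 0 = cp i * T.+1 -> s item 0 = i -> 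
  (forall j : 'I_m, residual d w s j = hits i w j) ->
  (a * \sum_(j < s 0 1) weight s j + b * \sum_(j < s 0 1) negative_part d w s j
    < b * \sum_(j < s 0 1) positive_part d w s j) = accepts i w.
Proof.
move=> tb sc si sr; have [sn sm sinc stab] := tb.
have [cp0 cpm _ _ _] := layoutP.
have pc : s pos (s comp 0) = cp i.
  by rewrite sc; have [_ _ ->] := stab _ (cpm i); rewrite mulnK.
have wE (j : 'I_m) : weight s j = test_weight i j.
  have [_ ty po] := stab _ (ltn_ord j).
  by rewrite /weight /relevant pc ty po sn.
have mE (j : 'I_m) : member s j = (i \in G j).
  have [ro _ _] := stab _ (ltn_ord j).
  by rewrite /member ro si sinc; case: (_ \in _).
have uE (j : 'I_m) x y : weight s j * (if i \in G j then x else unknown d w s j) =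
   test_weight i j * (if i \in G j then x else window i w j) /\
   weight s j * (if i \in G j then unknown d w s j else y) =
   test_weight i j * (if i \in G j then window i w j else y).
  rewrite wE /test_weight; case: ifPn => [/andP[c1 c2]|]; last by rewrite !mul0n.
  by rewrite (unknown_window tb sc si sr).
rewrite /accepts sm; congr (_ * _ + _ * _ < _ * _); apply: eq_bigr => j _ //.
- by rewrite /negative_part mE sr (uE _ 0 _).2.
- by rewrite /positive_part mE sr (uE _ _ 0).1.
Qed.

(** By the invariant the residuals are the ideal ones, so the decision is [accepts] and hence right;
    the subtraction then removes [i] from the residuals of [w] exactly when it carries [w]. *)
Lemma classify_step s (i : 'I_n) w : 0 < w <= d -> tables s ->
  s comp 0 = cp i * T.+1 -> s item 0 = i ->
  partial_state (cp i * T.+1) i w s ->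
  partial_state (cp i * T.+1) i w.+1 (den (classify a b d w) s).
Proof.
move=> /andP[w0 wd] tb sc si [so sr]; have [sn sm sinc stab] := tb.
have nd x : ~~ decoded (cp i * T.+1) i x =
    (cp i < cp x) || (cp i == cp x) && (i <= x).
  by rewrite /decoded ltn_mul2r eqn_mul2r /=; lia.
have srw (j : 'I_m) : residual d w s j = hits i w j.
  rewrite /residual sr ?w0 //; apply: eq_card => x.
  by rewrite !inE nd ltnn andbF andbT.
split.
  move=> x; have [-> _] := den_classify a b s x wd.
  rewrite (sums_accepts tb sc si srw) acceptsP ?w0 // si so.
  case: (eqVneq (x : nat) i) => [/val_inj -> | _]; last by rewrite !andbF.
  have -> : decoded (cp i * T.+1) i i = false.
    by apply/negbTE; rewrite nd; lia.
  rewrite /= andbT; case: (eqVneq (sigma i : nat) w) => [->|sw].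
    by rewrite w0 leqnn.
  by rewrite ltnS (leq_eqVlt (sigma i)) (negbTE sw).
move=> j w' /andP[w'0 w'd].
have [_ ->] := den_classify a b s 0 wd; last by [].
rewrite (sums_accepts tb sc si srw) acceptsP ?w0 // sm ltn_ord /=.
have [ro _ _] := stab _ (ltn_ord j).
case: (eqVneq w' w) => [->|w'w]; last first.
  rewrite andbF /residual sr ?w'0 //; apply: eq_card => x; rewrite !inE.
  by congr (_ && [&& _, _ & ~~ (_ && _)]); rewrite ltnS (leq_eqVlt w') (negbTE w'w).
rewrite andbT si ro sinc srw.
case: eqP => siw; last first.
  apply: eq_card => x; rewrite !inE nd ltnS leqnn andbT.
  case: (eqVneq (x : nat) i) => [/val_inj ->|_]; last by rewrite andbT.
  by case: eqP siw => //; rewrite !andbF.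
(* [hits] counts [i] itself whenever [i] lies in the pool, so the truncated subtraction is exact. *)
rewrite /hits (cardsD1 i) !inE siw !eqxx leqnn orbT andTb andbT.
rewrite addKn; apply: eq_card => x; rewrite !inE nd ltnS leqnn andbT.
by rewrite -(inj_eq val_inj) /=; case: (x == i :> nat); rewrite ?andbT ?andbF.
Qed.

Lemma classify_all_step s (i : 'I_n) w k : 0 < w -> w + k = d.+1 -> tables s ->
  s comp 0 = cp i * T.+1 -> s item 0 = i ->
  partial_state (cp i * T.+1) i w s ->
  partial_state (cp i * T.+1) i d.+1 (den (classify_all a b d (iota w k)) s).
Proof.
elim: k w s => [|k IH] w s w0; first by rewrite addn0 => ->.
move=> wk tb sc si ps.
have w0d : 0 < w <= d by lia.
rewrite [iota _ _]/= -[den _ s]/(den (PSeq (classify a b d w) (classify_all a b d (iota w.+1 k))) s) den_seq.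
apply: IH => //; [lia| | | |exact: classify_step].
- apply: tables_eq tb => x j hx; rewrite den_frame //.
  have /allP := isT : all (fun x => x \notin writes (classify a b d w)) [:: 0; inc; row; typ; pos].
  exact.
- by rewrite den_frame.
- by rewrite den_frame.
Qed.

Definition decoded_state (c i : nat) (s : memory) : Prop :=
  (forall x : 'I_n, s out x = if decoded c i x then sigma x : nat else 0)
  /\ forall (j : 'I_m) w', 0 < w' <= d -> s res (d.+1 * j + w') =
     #|[set x in G j | (sigma x == w' :> nat) && ~~ decoded c i x]|.

Lemma decoded_state_eq c i c' i' s : (forall x, decoded c i x = decoded c' i' x) ->
  decoded_state c i s -> decoded_state c' i' s.
Proof.
move=> E [h1 h2]; split=> [x|j w' hw]; first by rewrite -E.
by rewrite h2 //; apply: eq_card => x; rewrite !inE E.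
Qed.

Lemma partial_state1 c i s : decoded_state c i s <-> partial_state c i 1 s.
Proof.
have A x : (0 < (sigma x : nat) < 1) = false by lia.
split=> -[h1 h2]; split=> [x|j w' hw].
- by rewrite h1 A andbF orbF.
- rewrite h2 //; apply: eq_card => x; rewrite !inE.
  have -> : (w' < 1) = false by lia.
  by rewrite andbF /= andbT.
- by rewrite h1 A andbF orbF.
- rewrite h2 //; apply: eq_card => x; rewrite !inE.
  have -> : (w' < 1) = false by lia.
  by rewrite andbF /= andbT.
Qed.

(** Once the labels 1, ..., d have been tried, an item of label 0 is settled too: its output cell
    still has the initial value 0. *)
Lemma partial_state_full (i : 'I_n) s :
  partial_state (cp i * T.+1) i d.+1 s -> decoded_state (cp i * T.+1) i.+1 s.
Proof.
have E x : decoded (cp i * T.+1) i.+1 x = decoded (cp i * T.+1) i x || (x == i :> nat).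
  rewrite /decoded ltnS [x <= i]leq_eqVlt.
  by case: (eqVneq (x : nat) i) => [/val_inj ->|_]; rewrite ?eqxx /= ?orbT ?orbF.
move=> [h1 h2]; split=> [x|j w' hw].
  rewrite h1 E (ltn_ord (sigma x)) andbT; case: (decoded _ _ _) => //=.
  by case: (x == i :> nat) => //=; case: (nat_of_ord (sigma x)).
rewrite h2 //; apply: eq_card => x; rewrite !inE E negb_or.
have -> : (w' < d.+1) by lia.
by rewrite andbT.
Qed.

Lemma decode_items_step c s : c < m -> tables s -> s comp 0 = c ->
  c %/ T.+1 != 0 -> c %% T.+1 = 0 -> decoded_state c 0 s ->
  decoded_state c.+1 0 (den (PFor item false (decode_item a b d)) s).
Proof.
move=> cm tb sc pc tc st.
have [cp0 cpm G0 Gc _] := layoutP.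
have notw x : x \notin writes (classify a b d 0) ->
    x \notin writes (classify_all a b d (iota 1 d)).
  by move=> h; apply: contra h; exact: classify_all_writes.
have cE : c = c %/ T.+1 * T.+1 by rewrite {1}(divn_eq c T.+1) tc addn0.
suff H : decoded_state c (s 0 0) (den (PFor item false (decode_item a b d)) s).
  apply: decoded_state_eq H => x; rewrite /decoded ltn0 andbF orbF ltnS.
  by rewrite (leq_eqVlt (cp x * _)); have [-> _ _ _] := tb; rewrite ltn_ord andbT orbC.
apply: (@den_for (decoded_state c)) => //.
  rewrite [loops_ok _]/= cats0 inE negb_or !notw //= andbT.
  by elim: (iota 1 d) => // w ws IH; apply/andP.
have [sn _ _ _] := tb.
rewrite [s 0 _]sn => i z im fr zi zst.
pose i' := Ordinal im.
have frz x : x \notin item :: writes (classify a b d 0) -> forall j, z x j = s x j.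
  move=> hx j; have /andP[h1 h2] : (x != item) && (x \notin writes (classify a b d 0)).
    by rewrite -negb_or -in_cons.
  by rewrite fr // in_cons negb_or h1 /= cats0 notw.
have zt : tables z.
  apply: tables_eq tb => x j hx; apply: frz.
  have /allP := isT : all (fun x => x \notin item :: writes (classify a b d 0)) [:: 0; inc; row; typ; pos].
  exact.
have zc : z comp 0 = c by rewrite frz.
rewrite /decode_item den_if.
have -> : eval z (incidence comp) = (cp i' == c %/ T.+1).
  rewrite /= zi zc; have [_ _ zinc ztab] := zt.
  have [-> _ _] := ztab _ cm.
  rewrite -(Gc (Ordinal cm)) //; last by rewrite /=; case: (c) pc; rewrite ?div0n.
  exact: (zinc (Ordinal cm) i').
rewrite eqb0 negbK; case: eqP => [ci|nci].
  have ci' : cp i' * T.+1 = c by rewrite ci -cE.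
  rewrite -ci'; apply: partial_state_full; apply: classify_all_step => //.
    by rewrite zc.
  by apply/partial_state1; rewrite ci'.
apply: decoded_state_eq zst => x; rewrite /decoded.
congr (_ || _); case: (eqVneq (x : nat) i) => [xi|xi]; last by rewrite ltnS (leq_eqVlt x) (negbTE xi).
have -> : x = i' by apply: val_inj.
have -> : (cp i' * T.+1 == c) = false; last by [].
by apply/eqP => h; apply: nci; rewrite -h mulnK.
Qed.

Lemma decode_pools_correct s : tables s -> decoded_state 0 0 s ->
  forall x : 'I_n, den (decode_pools a b d) s out x = sigma x.
Proof.
move=> tb st x.
have [cp0 cpm G0 Gc _] := layoutP.
have [sn sm _ _] := tb.
have nw y : y \notin writes (classify a b d 0) ->
    (y \in writes (classify_all a b d (iota 1 d))) = false.
  by move=> h; apply/negP => /classify_all_writes; apply/negP.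
suff [H _] : decoded_state m 0 (den (decode_pools a b d) s).
  by rewrite H /decoded cpm.
rewrite -sm; apply: (@den_for (fun c => decoded_state c 0)) => //.
  rewrite /= !inE !mem_cat !in_nil !nw //= andbT.
  by elim: (iota 1 d) => // w ws IH; apply/andP.
rewrite [s 0 _]sm => c z cm fr zc zst.
have zt : tables z.
  apply: tables_eq tb => y j hy; rewrite fr //.
  rewrite !inE /= !mem_cat !in_nil !orbF.
  by rewrite !inE in hy; case/or4P: hy => [|||/orP[]] /eqP ->; rewrite nw.
have [_ _ _ ztab] := zt; have [ro ty po] := ztab _ cm.
rewrite /decode_pool !den_if.
have -> : eval z (Get pos (var comp)) = c %/ T.+1 by rewrite /= zc.
have -> : eval z (Get typ (var comp)) = c %% T.+1 by rewrite /= zc.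
(* Apart from the counting pools of positions at least 1, no pool triggers decoding, since
   [cp y * T.+1] is never such an index. *)
have skip : (c %/ T.+1 == 0) || (c %% T.+1 != 0) -> decoded_state c.+1 0 z.
  move=> h; apply: decoded_state_eq zst => y; rewrite /decoded !ltn0 !andbF !orbF ltnS.
  rewrite [RHS]leq_eqVlt; case: eqP => // yc.
  by move: h; rewrite -yc mulnK // modnMl eqxx orbF; have := cp0 y; lia.
case: (eqVneq (c %/ T.+1) 0) skip => [p0|p0] skip; first exact: skip.
case: (eqVneq (c %% T.+1) 0) skip => [t0|t0] skip; last exact: skip.
exact: decode_items_step.
Qed.

End Decoding.

Lemma nth_allpairs (m n : nat) (F : 'I_m -> 'I_n -> nat) (j : 'I_m) (i : 'I_n) :
  nth 0 [seq F j i | j <- enum 'I_m, i <- enum 'I_n] (j * n + i) = F j i.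
Proof.
have H (l : seq 'I_m) k (x : 'I_m) : k < size l -> nth 0 [seq F j i | j <- l, i <- enum 'I_n] (k * n + i)
    = F (nth x l k) i.
  elim: l k => // y l IH [|k] kl; rewrite allpairs_cons nth_cat size_map size_enum_ord.
    by rewrite mul0n add0n ltn_ord (nth_map i) ?size_enum_ord // nth_ord_enum.
  have -> : k.+1 * n + i < n = false by rewrite mulSn; lia.
  by rewrite mulSn -addnA addKn; exact: IH.
by rewrite (H _ _ j) ?size_enum_ord ?ltn_ord // nth_ord_enum.
Qed.

Lemma den_read_tee s N : s 0 0 = N -> s tee 0 = 0 ->
  den read_tee s tee 0 = \sum_(i < N) s inc i.
Proof.
move=> sn st.
pose I i (z : memory) := z tee 0 = \sum_(x < i) s inc x.
rewrite -sn; change (I (s 0 false) (den read_tee s)).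
apply: (@den_for I) => //; first by rewrite /I big_ord0.
move=> i z _ fr zi zI.
by rewrite den_incr /I updateE /= zI zi fr // big_ord_recr.
Qed.

Lemma den_tabulate s n m T : s 0 0 = n -> s 0 1 = m -> s tee 0 = T ->
  s row 0 = 0 -> s typ 0 = 0 -> s pos 0 = 0 ->
  forall j, j <= m -> let s' := den tabulate s in
  [/\ s' row j = j * n, s' typ j = j %% T.+1 & s' pos j = j %/ T.+1].
Proof.
move=> sn sm st r0 t0 p0.
pose I i (z : memory) := forall j, j <= i ->
  [/\ z row j = j * n, z typ j = j %% T.+1 & z pos j = j %/ T.+1].
suff H : I (s 0 true) (den tabulate s) by move=> j jm; apply: H; rewrite /= sm.
apply: (@den_for I) => //.
  by move=> j; rewrite leqn0 => /eqP ->; rewrite r0 t0 p0 div0n mod0n.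
move=> i z im fr zi zI.
have [ri ti pi] := zI i (leqnn _).
have zn : z 0 0 = n by rewrite fr.
have zT : z tee 0 = T by rewrite fr.
have dE := divn_eq i T.+1; have tT : i %% T.+1 < T.+1 by rewrite ltn_mod.
set p := i %/ T.+1 in pi dE *; set t := i %% T.+1 in ti dE tT *.
rewrite /tabulate_step den_seq den_if.
set z1 := den (PSet row _ _) z.
have z1E : z1 = update z row i.+1 (i.+1 * n).
  by rewrite /z1 /= zi addn1 ri zn mulSn addnC.
have -> : (eval z1 (Sub (var tee) (Get typ (var pool))) != 0) = (t < T).
  by rewrite z1E /= !updateE /= zi zT ti; lia.
move=> j; rewrite leq_eqVlt => /orP[/eqP -> {j}|ji]; last first.
  have [rj tj pj] := zI j ji.
  have jn : (j == i.+1) = false by lia.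
  have jn' : (j == i + 1) = false by lia.
  by case: ifP => _; rewrite z1E /= !updateE /= zi ?jn ?jn' /=.
case: ltnP => tl.
  have -> : i.+1 %% T.+1 = t.+1 by rewrite dE -addnS modnMDl modn_small.
  have -> : i.+1 %/ T.+1 = p by rewrite dE -addnS divnMDl // divn_small // addn0.
  by rewrite z1E /= !updateE /= zi addn1 !eqxx /= ti pi addn1.
have tT' : t.+1 = T.+1 by lia.
have iE : i.+1 = p.+1 * T.+1 by rewrite dE -addnS tT' mulSn addnC.
have -> : i.+1 %% T.+1 = 0 by rewrite iE modnMl.
have -> : i.+1 %/ T.+1 = p.+1 by rewrite iE mulnK.
by rewrite z1E /= !updateE /= zi addn1 !eqxx /= pi addn1.
Qed.

Lemma decoder_correct n m d T a b (k : 'I_d -> nat) (G : design n m) sigma cp :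
  0 < m -> layout T G cp ->
  (forall (i : 'I_n) w, 0 < w <= d -> accepts T a b G sigma cp i w = (sigma i == w :> nat)) ->
  forall x : 'I_n,
    den (decoder a b d) (encode_input k G (measure_design G sigma)) out x = sigma x.
Proof.
move=> m0 lay acc_ok x.
set s := encode_input _ _ _.
have sinc (j : 'I_m) (y : 'I_n) : s inc (j * n + y) = (y \in G j).
  by rewrite /s /encode_input /load /= (nth_allpairs (fun j i => (i \in G j : nat))).
have sres (j : 'I_m) w : 0 < w <= d -> s res (d.+1 * j + w) = #|[set y in G j | sigma y == w :> nat]|.
  move=> /andP[_ wd]; rewrite mulnC.
  rewrite /s /encode_input /load /=.
  have := nth_allpairs (fun j w => measure_design G sigma j w) j (Ordinal (wd : w < d.+1)).
  rewrite /= => ->; rewrite !ffunE -sum1_card [LHS]big_mkcond [RHS]big_mkcond /=.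
  by apply: eq_bigr => y _; rewrite inE -val_eqE /=; case: (_ \in _) => //; case: (_ == _).
have sZ y j : 2 < y -> s y j = 0.
  by case: y => [|[|[|y]]] // _; rewrite /s /encode_input /load /= nth_nil nth_nil.
have [cp0 cpm G0 Gc Gt] := lay.
rewrite /decoder !den_seq; set s1 := den read_tee s; set s2 := den tabulate s1.
have s1E y j : y \notin [:: tee; item] -> s1 y j = s y j.
  by rewrite !inE negb_or => /andP[h1 h2]; rewrite /s1 den_frame // /= !inE negb_or h2.
have s2E y j : y \notin [:: tee; item; pool; row; typ; pos] -> s2 y j = s y j.
  rewrite !inE !negb_or => /and5P[h1 h2 h3 h4 /andP[h5 h6]].
  rewrite /s2 den_frame ?s1E //= ?inE !negb_or ?h1 ?h2 //.
  by rewrite h3 h4 h5 h6.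
have sT : s1 tee 0 = T.
  rewrite /s1 (den_read_tee (N := n)) // ?sZ //.
  rewrite -(G0 (Ordinal m0)) // -sum1_card [RHS]big_mkcond /=; apply: eq_bigr => y _.
  by have := sinc (Ordinal m0) y; rewrite /= mul0n add0n => ->; case: (_ \in _).
have tab := den_tabulate (s1E 0 0 isT) (s1E 0 1 isT) sT.
apply: (decode_pools_correct (T := T) (G := G) (cp := cp)) => //.
  split; rewrite ?s2E //; first by move=> j y; rewrite s2E.
  move=> j jm; have := tab _ _ _ j (ltnW jm); apply; by rewrite s1E // ?sZ.
have D0 y : decoded T cp 0 0 y = false by rewrite /decoded !ltn0 andbF.
split=> [y|j w hw]; first by rewrite s2E // ?sZ // D0.
rewrite s2E // sres //; apply: eq_card => y; rewrite !inE D0 andbT.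
by [].
Qed.

(** [inord] only provides the type: [bounded_decoder] keeps every output cell at most [d] on
    arbitrary input, so no value is altered. *)
Definition decode_labels (a b n m d : nat) (k : 'I_d -> nat) (G : design n m)
    (y : histograms m d) : labelling n d :=
  [ffun i : 'I_n => inord (den (decoder a b d) (encode_input k G y) out i)].

(** Every loop runs up to n or m, and C + 1 times n bounds both; this is the polynomial substituted
    into [cost]. *)
Lemma polynomial_time_decode (a b d C : nat) (k : nat -> 'I_d -> nat) (m : nat -> nat) :
  (forall n, m n <= C * n) ->
  polynomial_time k (fun n => @decode_labels a b n (m n) d (k n)).
Proof.
move=> mC; have [lk w0] := loops_ok_decoder a b d.
exists (compile (decoder a b d)), (cost (decoder a b d) \Po (C.+1%:P * 'X))%R => n G y _.
set s := encode_input _ _ _.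
have sn : s 0 0 <= C.+1 * n by rewrite [s 0 0]/= mulSn leq_addr.
have sm : s 0 1 <= C.+1 * n.
  by rewrite [s 0 1]/= mulSn (leq_trans (mC n)) // leq_addl.
have [t ex tc] := exec_compile lk sn sm w0.
exists t, (den (decoder a b d) s); split => //.
  by rewrite horner_comp hornerM hornerC hornerX.
move=> i; rewrite ffunE inordK // ltnS.
apply: den_bounded (bounded_decoder a b d) _ i => j.
by rewrite /s /encode_input /load /= nth_nil.
Qed.

End Decoder.

Local Open Scope ring_scope.

(** * Concentration *)

(** Comparison of power series: odd terms cancel, and (2k)! >= 2^k k! compares the even ones. *)
Lemma expR_cosh (R : realType) (x : R) : expR x + expR (- x) <= 2 * expR (x ^+ 2 / 2).
Proof.
have fact_le k : (k`! * 2 ^ k <= (k.*2)`!)%N.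
  elim: k => // k IH; rewrite doubleS !factS expnS.
  have -> : (k.+1 * k`! * (2 * 2 ^ k) = k.*2.+2 * (k`! * 2 ^ k))%N by rewrite -muln2; ring.
  by rewrite leq_mul // (leq_trans IH) // leq_pmull.
have E k : (series (exp_coeff x) + series (exp_coeff (- x))) k.*2
    <= 2 * series (exp_coeff (x ^+ 2 / 2)) k.
  rewrite /series /=.
  have -> z y : (z + y) k.*2 = z k.*2 + y k.*2 :> R by [].
  elim: k => [|k IH]; first by rewrite !big_geq // addr0 mulr0.
  rewrite doubleS !big_nat_recr //= mulrDr.
  set A := \sum_(0 <= i < k.*2) _ in IH *; set B := \sum_(0 <= i < k.*2) _ in IH *.
  rewrite /exp_coeff /=.
  have -> : (- x) ^+ k.*2 = x ^+ k.*2 by rewrite -mul2n !exprM sqrrN.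
  have -> : (- x) ^+ k.*2.+1 = - x ^+ k.*2.+1.
    by rewrite !exprS -mul2n !exprM sqrrN mulNr.
  have le : x ^+ k.*2 / (k.*2)`!%:R <= (x ^+ 2 / 2) ^+ k / k`!%:R.
    rewrite expr_div_n -exprM mul2n -mulrA -invfM ler_wpM2l //.
      by rewrite -mul2n exprM exprn_ge0 ?sqr_ge0.
    rewrite lef_pV2 ?posrE ?mulr_gt0 ?exprn_gt0 ?ltr0n ?fact_gt0 //.
    by rewrite -natrX -natrM ler_nat mulnC.
  lra.
pose u := series (exp_coeff x) + series (exp_coeff (- x)).
(* The comparison treats only even partial sums; monotonicity transfers it to all of them. *)
have uS : nondecreasing_seq u.
  apply/nondecreasing_seqP => k.
  have -> : u k.+1 = u k + (exp_coeff x k + exp_coeff (- x) k).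
    rewrite /u /series /= -[LHS]/(\sum_(0 <= i < k.+1) exp_coeff x i + \sum_(0 <= i < k.+1) exp_coeff (- x) i).
    rewrite !big_nat_recr //= -[(_ + _) k]/(\sum_(0 <= i < k) exp_coeff x i + \sum_(0 <= i < k) exp_coeff (- x) i).
    by rewrite addrACA.
  rewrite lerDl /exp_coeff /= -mulrDl mulr_ge0 ?invr_ge0 //.
  rewrite -[k]odd_double_half exprD [(- x) ^+ _]exprD -mul2n.
  have h : 0 <= x ^+ (2 * k./2) by rewrite exprM exprn_ge0 ?sqr_ge0.
  have -> : (- x) ^+ (2 * k./2) = x ^+ (2 * k./2) by rewrite !exprM sqrrN.
  by rewrite -mulrDl mulr_ge0 //; case: (odd k); rewrite ?expr1 ?expr0 ?subrr.
have cx y : cvgn (series (exp_coeff y)) by exact: is_cvg_series_exp_coeff.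
have -> : expR x + expR (- x) = limn u by rewrite /u; apply/esym/limD; exact: cx.
apply: limr_le; first by apply: is_cvgD; exact: cx.
apply: nearW => k; apply: le_trans (uS k k.*2 _) _.
  by rewrite -addnn; exact: leq_addr.
apply: le_trans (E k) _; rewrite ler_pM2l //.
apply: nondecreasing_cvgn_le; last exact: cx.
apply: (@nondecreasing_series R _ xpredT 0%N) => i _ _.
by rewrite exp_coeff_ge0 // divr_ge0 // sqr_ge0.
Qed.

Section Signs.
Variables (R : realType) (m n : nat).
Local Notation signs := {ffun 'I_m * 'I_n -> bool}.

Definition sgn (b : bool) : R := if b then 1 else -1.

Definition correlation (g : 'I_m -> 'I_n -> R) (i : 'I_n) (e : signs) : R :=
  \sum_j \sum_x g j x * (sgn (e (j, i)) * sgn (e (j, x))).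

(* Multiplying the columns other than [i] by column [i] preserves the uniform
   distribution and turns the correlation into a sum of independent terms. *)
Lemma correlation_mgf (g : 'I_m -> 'I_n -> R) (i : 'I_n) :
  (forall j, g j i = 0) ->
  \sum_(e : signs) expR (correlation g i e)
    <= #|{: signs}|%:R * expR ((\sum_j \sum_x g j x ^+ 2) / 2).
Proof.
move=> gi.
pose phi (e : signs) : signs :=
  [ffun p => if p.2 == i then e p else e p == e (p.1, i)].
have phiK : involutive phi.
  move=> e; apply/ffunP => -[j x]; rewrite !ffunE /= eqxx.
  by case: eqVneq => // _; case: (e (j, x)); case: (e (j, i)).
rewrite (reindex_inj (inv_inj phiK)) /=.
have E e : expR (correlation g i (phi e)) = \prod_p expR (g p.1 p.2 * sgn (e p)).
  rewrite -expR_sum /correlation pair_big /=; congr expR; apply: eq_bigr => -[j x] _ /=.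
  rewrite !ffunE /= eqxx; case: eqVneq => [->|_]; first by rewrite gi !mul0r.
  congr (_ * _); rewrite /sgn.
  by case: (e (j, x)); case: (e (j, i)); rewrite /= ?mulr1 ?mulrNN ?mul1r.
rewrite (eq_bigr _ (fun e _ => E e)).
rewrite -(bigA_distr_bigA (fun p (b : bool) => expR (g p.1 p.2 * sgn b))) /=.
apply: (@le_trans _ _ (\prod_(p : 'I_m * 'I_n) (2 * expR (g p.1 p.2 ^+ 2 / 2)))).
  apply: ler_prod => p _; rewrite big_bool /sgn mulr1 mulrN1 expR_cosh andbT.
  by rewrite addr_ge0 ?expR_ge0.
rewrite big_split /= prodr_const -expR_sum card_ffun card_bool natrX.
by rewrite pair_big /= mulr_suml.
Qed.

Lemma correlation_tail (g : 'I_m -> 'I_n -> R) (i : 'I_n) (t V : R) :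
  (forall j, g j i = 0) -> \sum_j \sum_x g j x ^+ 2 <= V -> 0 < V -> 0 <= t ->
  #|[set e : signs | t <= correlation g i e]|%:R
    <= #|{: signs}|%:R * expR (- (t ^+ 2 / (2 * V))).
Proof.
(* The minimiser of l^2 V / 2 - l t in the Chernoff bound. *)
move=> gi gV V0 t0; pose l := t / V.
have l0 : 0 <= l by rewrite divr_ge0 // ltW.
pose gl j x := l * g j x.
have corl e : correlation gl i e = l * correlation g i e.
  rewrite /correlation mulr_sumr; apply: eq_bigr => j _.
  by rewrite mulr_sumr; apply: eq_bigr => x _; rewrite /gl -mulrA.
have gli j : gl j i = 0 by rewrite /gl gi mulr0.
have H := correlation_mgf gli.
have sq : (\sum_j \sum_x gl j x ^+ 2) / 2 <= l ^+ 2 * V / 2.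
  rewrite ler_pM2r ?invr_gt0 //.
  have -> : \sum_j \sum_x gl j x ^+ 2 = l ^+ 2 * \sum_j \sum_x g j x ^+ 2.
    rewrite mulr_sumr; apply: eq_bigr => j _.
    by rewrite mulr_sumr; apply: eq_bigr => x _; rewrite /gl exprMn.
  by rewrite ler_wpM2l // sqr_ge0.
have -> : - (t ^+ 2 / (2 * V)) = l ^+ 2 * V / 2 - l * t.
  by rewrite /l; field; rewrite gt_eqF.
apply: (@le_trans _ _ (\sum_(e : signs) expR (correlation gl i e) * expR (- (l * t)))).
  rewrite -sum1_card natr_sum big_mkcond /=; apply: ler_sum => e _.
  rewrite inE; case: ifPn => [te|_]; last by rewrite mulr_ge0 ?expR_ge0.
  rewrite -expRD corl; apply: le_trans (expR_ge1Dx _).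
  by rewrite lerDl subr_ge0 ler_wpM2l.
rewrite -mulr_suml expRD mulrA ler_pM2r ?expR_gt0 //.
by apply: le_trans H _; rewrite ler_wpM2l // ler_expR.
Qed.

End Signs.

(** Chernoff bound with a free parameter [l]: the hashes are independent, so the exponential moment
    is a product, each item of [A] giving a factor 1 + (e^l - 1) / (L + 1) after normalisation. *)
Lemma occupancy_tail (R : realType) (n L : nat) (A : {set 'I_n}) (c : 'I_L.+1) (l kappa : R) :
  0 <= l ->
  #|[set h : {ffun 'I_n -> 'I_L.+1} | kappa <= #|[set x in A | h x == c]|%:R]|%:R
    <= #|{: {ffun 'I_n -> 'I_L.+1}}|%:R
       * expR ((expR l - 1) * (#|A|%:R / L.+1%:R) - l * kappa).
Proof.
move=> l0; pose F (x : 'I_n) (c' : 'I_L.+1) : R := expR (l * ((x \in A) && (c' == c))%:R).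
have E (h : {ffun 'I_n -> 'I_L.+1}) :
    expR (l * #|[set x in A | h x == c]|%:R) = \prod_x F x (h x).
  rewrite -expR_sum -mulr_sumr -natr_sum -sum1_card [in LHS]big_mkcond /=.
  by congr (expR (_ * _%:R)); apply: eq_bigr => x _; rewrite inE; case: ifP.
apply: (@le_trans _ _ (\sum_(h : {ffun 'I_n -> 'I_L.+1}) (\prod_x F x (h x)) * expR (- (l * kappa)))).
  rewrite -sum1_card natr_sum big_mkcond /=; apply: ler_sum => h _; rewrite -E.
  rewrite inE; case: ifPn => [hk|_]; last by rewrite mulr_ge0 ?expR_ge0.
  rewrite -expRD; apply: le_trans (expR_ge1Dx _).
  by rewrite lerDl subr_ge0 ler_wpM2l.
rewrite -mulr_suml -bigA_distr_bigA expRD mulrA ler_pM2r ?expR_gt0 //.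
apply: (@le_trans _ _ (\prod_(x : 'I_n) (L.+1%:R * expR ((expR l - 1) / L.+1%:R * (x \in A)%:R)))).
  apply: ler_prod => x _; apply/andP; split; first by apply: sumr_ge0 => c' _; exact: expR_ge0.
  rewrite /F; case: (x \in A) => /=; last first.
    rewrite (eq_bigr (fun=> 1)) => [|c' _]; last by rewrite mulr0 expR0.
    by rewrite sumr_const card_ord mulr0 expR0 mulr1.
  rewrite (bigD1 c) //= eqxx mulr1 (eq_bigr (fun=> 1)); last first.
    by move=> c' /negbTE ->; rewrite mulr0 expR0.
  rewrite sumr_const cardC1 card_ord mulr1 /=.
  have L0 : 0 < L.+1%:R :> R by rewrite ltr0n.
  have -> : expR l + L%:R = L.+1%:R * (1 + (expR l - 1) / L.+1%:R).
    by rewrite -natr1; field; rewrite natr1 gt_eqF.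
  by rewrite ler_pM2l // expR_ge1Dx.
rewrite big_split /= prodr_const -expR_sum card_ffun !card_ord natrX -mulr_sumr -natr_sum.
rewrite ler_pM2l ?exprn_gt0 ?ltr0n // ler_expR -sum1_card.
by rewrite -mulrA [L.+1%:R^-1 * _]mulrC [in leRHS]big_mkcond.
Qed.

(** * The score of an item under the random design *)

Lemma sum_divn_modn (V : nmodType) (P Q : nat) (F : nat -> nat -> V) : (0 < Q)%N ->
  \sum_(j < P * Q) F (j %/ Q)%N (j %% Q)%N = \sum_(p < P) \sum_(t < Q) F p t.
Proof.
move=> Q0; elim: P => [|P IH]; first by rewrite !big_ord0.
rewrite big_ord_recr /= -IH mulSnr big_split_ord /=; congr (_ + _).
apply: eq_bigr => t _; rewrite divnMDl // divn_small // addn0.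
by rewrite modnMDl modn_small.
Qed.

(** Each lag from 1 to P - c belongs to exactly one position, which carries T random pools. *)
Lemma sum_tests (V : nmodType) (P T c : nat) (f : nat -> V) :
  \sum_(j < P * T.+1) (if (c <= j %/ T.+1)%N && (j %% T.+1 != 0)%N
     then f ((j %/ T.+1).+1 - c)%N else 0) = (\sum_(l < P - c) f l.+1) *+ T.
Proof.
rewrite (sum_divn_modn P (fun p t => if (c <= p)%N && (t != 0)%N then f (p.+1 - c)%N else 0)) //.
under eq_bigr => p _.
  rewrite big_ord_recl /= andbF add0r.
  rewrite (eq_bigr (fun=> if (c <= p)%N then f (p.+1 - c)%N else 0)); last first.
    by move=> t _; rewrite andbT.
  rewrite sumr_const card_ord.
  over.
rewrite sumrMnl; congr (_ *+ _).
rewrite -big_mkcond /= -(big_mkord (fun p => c <= p)%N (fun p => f (p.+1 - c)%N)).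
case: (leqP c P) => cP; last first.
  have -> : (P - c = 0)%N by lia.
  by rewrite big_ord0 big_nat_cond big1 // => p; lia.
rewrite (big_cat_nat (n := c)) //= [X in X + _]big_nat_cond big1 ?add0r; last by move=> p; lia.
rewrite -{1}[c]add0n big_addn big_mkord.
by apply: eq_big => [l|l _]; rewrite ?leq_addl // -addSn addnK.
Qed.

Definition harmonic_sum (R : realType) (c : nat) : R := \sum_(l < c) l.+1%:R^-1.

(* Pool 0 only tells the decoder T, by its size; the other pools of position 0
   are empty, since compartments are numbered from 1. *)
Definition random_design (n m L T : nat) (h : {ffun 'I_n -> 'I_L.+1})
    (e : {ffun 'I_m * 'I_n -> bool}) : design n m :=
  [ffun j : 'I_m => [set x : 'I_n |
     if j == 0 :> nat then (x < T)%N
     else if (j %% T.+1 == 0)%N then ((h x).+1 == j %/ T.+1)%N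
     else ((h x).+1 <= j %/ T.+1)%N && e (j, x)]].

Section RandomDesign.
Variables (R : realType) (n d m L P T a b : nat) (sigma : labelling n d).

Lemma layout_random (h : {ffun 'I_n -> 'I_L.+1}) e :
  (T <= n)%N -> m = (P * T.+1)%N -> (L.+1 < P)%N ->
  layout T (random_design T h e : design n m) (fun x => (h x).+1).
Proof.
move=> Tn mE LP; split=> [//|x|j j0|j x j0 t0|j x t0].
- rewrite mE ltn_mul2r /=; have := ltn_ord (h x); lia.
- rewrite ffunE j0 eqxx -sum1_card big_mkcond /=.
  rewrite (eq_bigr (fun x : 'I_n => (x < T)%N : nat)); last first.
    by move=> x _; rewrite inE; case: ifP.
  have -> : (\sum_(x < n) (x < T)%N = \sum_(x < n | (x < T)%N) 1)%N.
    by rewrite [RHS]big_mkcond; apply: eq_bigr => x _; case: (_ < _)%N.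
  by rewrite -(big_ord_widen _ (fun=> 1%N) Tn) sum1_card card_ord.
- by rewrite ffunE inE (gtn_eqF j0) t0 eqxx.
- rewrite ffunE inE; case: ifP => [/eqP j0|_]; first by rewrite j0 mod0n in t0.
  by rewrite (negbTE t0) => /andP[].
Qed.

Variable h : {ffun 'I_n -> 'I_L.+1}.
Local Notation cp := (fun x => (h x).+1).

(** The coefficient with which the sign of [x] enters the score of [i] through pool [j]. The item
    itself is left out: its product of signs is 1 and forms the signal. *)
Definition influence (i : 'I_n) (w : nat) (j : 'I_m) (x : 'I_n) : R :=
  if [&& x \in remaining sigma cp i w, x != i & (h x < j %/ T.+1)%N]
  then (test_weight T cp i j)%:R else 0.

(** In a random pool, twice [hits] minus [window] is the sum of the signs of the remaining items in
    reach, and the branch on membership multiplies it by the sign of [i]. The term x = i, present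
    only if [i] carries [w], is a square and yields the full weight; the others are noise. *)
Lemma accepts_correlation e (i : 'I_n) w :
  accepts T a b (random_design T h e : design n m) sigma cp i w =
  (a%:R * (\sum_(j < m) test_weight T cp i j)%:R
    < b%:R * ((sigma i == w :> nat)%:R * (\sum_(j < m) test_weight T cp i j)%:R
              + correlation (influence i w) i e)).
Proof.
set W := (\sum_(j < m) test_weight T cp i j)%N.
set G := random_design T h e.
rewrite /accepts -/G -/W.
set M := (\sum_(j < m) _ * (if _ then window _ _ _ _ _ _ else _))%N.
set Q := (\sum_(j < m) _ * (if _ then 2 * _ else _))%N.
have -> : (sigma i == w :> nat)%:R * W%:R + correlation (influence i w) i e = Q%:R - M%:R.
  rewrite /Q /M /W !natr_sum mulr_sumr /correlation -big_split -sumrB /=.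
  apply: eq_bigr => j _.
  rewrite /influence /test_weight; case: ifPn => [/andP[cj tj]|_]; last first.
    rewrite mulr0 add0r !mul0n subrr big1 // => x _.
    by case: ifP => _; rewrite mul0r.
  set q := (n %/ _)%N.
  have hitsE : (hits G sigma cp i w j)%:R = \sum_(x in remaining sigma cp i w)
      ((h x < j %/ T.+1)%N && e (j, x))%:R :> R.
    rewrite /hits -sum1_card natr_sum big_mkcond [RHS]big_mkcond /=; apply: eq_bigr => x _.
    rewrite !inE ffunE inE; case: (eqVneq (j : nat) 0%N) => [j0|_].
      by rewrite j0 mod0n in tj.
    by rewrite (negbTE tj); case: ((h x < _)%N && _) => //=; case: ifP.
  have winE : (window T sigma cp i w j)%:R = \sum_(x in remaining sigma cp i w)
      ((h x < j %/ T.+1)%N)%:R :> R.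
    rewrite /window -sum1_card natr_sum big_mkcond [RHS]big_mkcond /=; apply: eq_bigr => x _.
    by rewrite !inE; case: (h x < j %/ _)%N; rewrite ?andbT ?andbF //=; case: ifP.
  have diffE : 2 * (hits G sigma cp i w j)%:R - (window T sigma cp i w j)%:R =
      \sum_(x in remaining sigma cp i w | (h x < j %/ T.+1)%N) sgn R (e (j, x)).
    rewrite hitsE winE mulr_sumr -sumrB [RHS]big_mkcondr /=; apply: eq_bigr => x _.
    by case: (h x < _)%N; case: (e _); rewrite /sgn /=; ring.
  have iG : (i \in G j) = e (j, i).
    rewrite ffunE inE; case: (eqVneq (j : nat) 0%N) => [j0|_].
      by rewrite j0 mod0n in tj.
    by rewrite (negbTE tj) cj.
  have -> : (q * (if i \in G j then 2 * hits G sigma cp i w j else window T sigma cp i w j))%:R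
    - (q * (if i \in G j then window T sigma cp i w j else 2 * hits G sigma cp i w j))%:R
    = q%:R * (sgn R (e (j, i)) * \sum_(x in remaining sigma cp i w | (h x < j %/ T.+1)%N) sgn R (e (j, x))).
    by rewrite -diffE iG /sgn; case: (e _); rewrite !natrM; ring.
  have sq bb : sgn R bb * sgn R bb = 1 by rewrite /sgn; case: bb; ring.
  have irem : (i \in remaining sigma cp i w) = (sigma i == w :> nat).
    by rewrite inE eqxx leqnn orbT andbT.
  rewrite mulr_sumr.
  have -> : \sum_x (if [&& x \in remaining sigma cp i w, x != i & (h x < j %/ T.+1)%N]
      then q%:R else 0) * (sgn R (e (j, i)) * sgn R (e (j, x))) =
     \sum_(x in remaining sigma cp i w | (h x < j %/ T.+1)%N && (x != i))
        q%:R * (sgn R (e (j, i)) * sgn R (e (j, x))).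
    rewrite [RHS]big_mkcond /=; apply: eq_bigr => x _.
    by rewrite andbA andbAC -!andbA; case: ifP; rewrite ?mul0r.
  rewrite mulr_sumr; case: (boolP (sigma i == w :> nat)) => siw; last first.
    rewrite mul0r add0r; apply: eq_bigl => x; case: (eqVneq x i) => [->|]; last by rewrite andbT.
    by rewrite irem (negbTE siw).
  rewrite [RHS](bigD1 i) /=; last by rewrite irem siw cj.
  rewrite sq mulr1 mul1r; congr (_ + _).
  by apply: eq_bigl => x; rewrite andbA.
rewrite mulrBr ltrBrDr -!natrM -natrD ltr_nat.
by [].
Qed.

Variable kappa : R.
Hypothesis occupancy : forall (w : nat) (c : 'I_L.+1), (0 < w <= d)%N ->
  #|[set x in [set x | sigma x == w :> nat] | h x == c]|%:R <= kappa.

Lemma window_le (i : 'I_n) w p : (0 < w <= d)%N -> (h i < p)%N -> 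
  #|[set x in remaining sigma cp i w | (h x < p)%N]|%:R <= kappa * (p - h i)%:R.
Proof.
move=> wd hp.
apply: (@le_trans _ _ (\sum_(c < L.+1 | (h i <= c < p)%N)
    #|[set x in [set x | sigma x == w :> nat] | h x == c]|%:R)).
  rewrite -natr_sum ler_nat -sum1_card.
  under [leqRHS]eq_bigr => c _ do rewrite -sum1_card.
  rewrite (exchange_big_dep (fun x => sigma x == w :> nat)) /=; last first.
    by move=> c x _; rewrite !inE => /andP[].
  rewrite big_mkcond [leqRHS]big_mkcond /=; apply: leq_sum => x _.
  rewrite !inE; case: (eqVneq (sigma x : nat) w) => //= sw.
  case: ifPn => // /andP[hx xp].
  rewrite (bigD1 (h x)) /= ?leq_addr // inE inE sw !eqxx andbT xp andbT.
  by move: hx; rewrite eqSS ltnS; lia.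
apply: (@le_trans _ _ (\sum_(c < L.+1 | (h i <= c < p)%N) kappa)).
  by apply: ler_sum => c _; exact: occupancy.
have k0 : 0 <= kappa by apply: le_trans (occupancy (h i) wd).
rewrite sumr_const -[kappa *+ _]mulr_natr ler_wpM2l // ler_nat.
rewrite cardE -(size_map val) -[(p - h i)%N](size_iota (h i)).
apply: uniq_leq_size; first by rewrite (map_inj_uniq val_inj) enum_uniq.
move=> c /mapP[c' + ->]; rewrite mem_enum mem_iota => /andP[h1 h2].
by rewrite h1 subnKC // ltnW.
Qed.

Hypothesis mE : m = (P * T.+1)%N.

(** A pool at lag l has weight at most n / l and at most kappa l noisy items, so it contributes at
    most kappa n^2 / l; each lag occurs T times. *)
Lemma influence_sqr (i : 'I_n) w : (0 < w <= d)%N ->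
  \sum_j \sum_x influence i w j x ^+ 2
    <= kappa * n%:R ^+ 2 * T%:R * harmonic_sum R (P - (h i).+1).
Proof.
move=> wd.
have k0 : 0 <= kappa by apply: le_trans (occupancy (h i) wd).
apply: (@le_trans _ _ (\sum_(j < m) (if (cp i <= j %/ T.+1)%N && (j %% T.+1 != 0)%N
   then kappa * n%:R ^+ 2 * ((j %/ T.+1).+1 - cp i)%N%:R^-1 else 0))).
  apply: ler_sum => j _; rewrite /influence /test_weight.
  case: ifPn => [/andP[cj tj]|_]; last first.
    by rewrite big1 // => x _; case: ifP; rewrite expr0n.
  rewrite subSS; set l := (_ - _)%N; have l0 : (0 < l)%N by rewrite subn_gt0.
  apply: (@le_trans _ _ ((n %/ l)%N%:R ^+ 2 * #|[set x in remaining sigma cp i w | (h x < j %/ T.+1)%N]|%:R)).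
    rewrite -sum1_card natr_sum mulr_sumr [leRHS]big_mkcond /=; apply: ler_sum => x _.
    move: (remaining _ _ _ _) => A.
    rewrite inE; case: (x \in A) => /=; last by rewrite expr0n.
    case: (_ < j %/ _)%N; rewrite ?andbT ?andbF ?expr0n // mulr1.
    by case: ifP; rewrite ?expr0n ?sqr_ge0.
  have ql : (n %/ l)%N%:R <= n%:R / l%:R :> R.
    by rewrite ler_pdivlMr ?ltr0n // -natrM ler_nat leq_trunc_div.
  have := window_le wd cj; rewrite -/l => wl.
  apply: (@le_trans _ _ ((n%:R / l%:R) ^+ 2 * (kappa * l%:R))).
    by rewrite ler_pM ?sqr_ge0 // lerXn2r ?nnegrE ?divr_ge0.
  rewrite (_ : (n%:R / l%:R) ^+ 2 * (kappa * l%:R) = kappa * n%:R ^+ 2 / l%:R) //.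
  by field; rewrite pnatr_eq0 -lt0n.
by rewrite mE (sum_tests P T (cp i) (fun l => kappa * n%:R ^+ 2 / l%:R)) -mulr_sumr
  -mulrnAr -[X in _ * X]mulr_natl mulrA.
Qed.

(** Rounding n / l down loses at most 1 per lag, which after division by n is the subtracted
    term. *)
Lemma test_weight_sum (i : 'I_n) :
  (\sum_(j < m) test_weight T cp i j)%:R
    >= T%:R * n%:R * (harmonic_sum R (P - (h i).+1) - (P - (h i).+1)%N%:R / n%:R).
Proof.
have n0 : (0 < n)%N by apply: leq_ltn_trans (ltn_ord i).
have natMn x y : x *+ y = (x * y)%N.
  by elim: y => [|y IH]; rewrite ?muln0 // mulrS IH mulnS.
rewrite mE (sum_tests P T (cp i) (fun l => n %/ l)%N) natMn mulnC natrM -mulrA ler_wpM2l //.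
rewrite mulrBr mulrCA mulfV ?pnatr_eq0 -?lt0n // mulr1 natr_sum /harmonic_sum mulr_sumr.
rewrite -[X in _ - X%:R]card_ord -sum1_card natr_sum -sumrB; apply: ler_sum => l _.
rewrite lerBlDr natr1 ltW // ltr_pdivrMr ?ltr0n // -natrM ltr_nat.
by rewrite ltn_ceil.
Qed.

End RandomDesign.

(** * Union bound over all failure events *)

Section Failure.
Variables (R : realType) (n d m L P T a b : nat) (sigma : labelling n d).
Hypothesis T0 : (0 < T)%N.
Hypothesis mE : m = (P * T.+1)%N.
Hypothesis LP : (L.+1 < P)%N.
Hypothesis Pn : (P <= n)%N.
Hypothesis ab : (a <= b)%N.
Hypothesis b0 : (0 < b)%N.
Variables (kappa Z : R).
Hypothesis kappa0 : 0 < kappa.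
Hypothesis ZP : forall c, (P - L.+1 <= c)%N ->
  Z <= T%:R / kappa * (harmonic_sum R c - 2).
Local Notation signs := {ffun 'I_m * 'I_n -> bool}.
Local Notation hashes := {ffun 'I_n -> 'I_L.+1}.

Definition occupied (h : hashes) : bool :=
  [forall w : 'I_d.+1, forall c : 'I_L.+1, (0 < w)%N ==>
     (#|[set x in [set x | sigma x == w :> nat] | h x == c]|%:R <= kappa)].

Definition wrong (h : hashes) (i : 'I_n) (w : nat) : {set signs} :=
  [set e : signs | accepts T a b (random_design T h e) sigma (fun x => (h x).+1) i w
                   != (sigma i == w :> nat)].

Lemma wrong_bound h i w : (0 < w <= d)%N -> occupied h ->
  #|wrong h i w|%:R <= #|{: signs}|%:R *
    expR (- ((if sigma i == w :> nat then 1 - a%:R / b%:R else a%:R / b%:R) ^+ 2 * Z / 2)).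
Proof.
move=> wd oc.
have occ (w' : nat) (c : 'I_L.+1) : (0 < w' <= d)%N ->
    #|[set x in [set x | sigma x == w' :> nat] | h x == c]|%:R <= kappa.
  move=> /andP[w0 wd']; have /forallP/(_ (Ordinal (wd' : w' < d.+1)%N))/forallP/(_ c)/implyP := oc.
  by apply.
have n0 : (0 < n)%N by apply: leq_ltn_trans (ltn_ord i).
pose c := (P - (h i).+1)%N.
have c0 : (0 < c)%N by have := ltn_ord (h i); rewrite /c; lia.
have cn : (c <= n)%N by rewrite /c; lia.
have ZPc : Z <= T%:R / kappa * (harmonic_sum R c - 2).
  by apply: ZP; have := ltn_ord (h i); rewrite /c; lia.
set H := harmonic_sum R c in ZPc.
have H1 : 1 <= H.
  rewrite /H /harmonic_sum; case: (c) c0 => // c' _.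
  by rewrite big_ord_recl /= invr1 lerDl sumr_ge0.
pose V := kappa * n%:R ^+ 2 * T%:R * H.
have nR : 0 < n%:R :> R by rewrite ltr0n.
have TR : 0 < T%:R :> R by rewrite ltr0n.
have bR : 0 < b%:R :> R by rewrite ltr0n.
have V0 : 0 < V by rewrite !mulr_gt0 // (lt_le_trans _ H1).
pose W : R := (\sum_(j < m) test_weight T (fun x => (h x).+1) i j)%:R.
have WH : T%:R * n%:R * (H - 1) <= W.
  apply: le_trans (test_weight_sum R h mE i).
  rewrite ler_pM2l ?mulr_gt0 // lerD2l lerNl opprK.
  by rewrite ler_pdivrMr // mul1r ler_nat.
(* With W >= T n (H - 1) and V = kappa n^2 T H this rests on (H - 1)^2 >= H (H - 2), the origin of
   the 2 in [ZP]. *)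
have ZV : Z * V <= W ^+ 2.
  apply: (@le_trans _ _ ((T%:R * n%:R * (H - 1)) ^+ 2)); last first.
    rewrite lerXn2r ?nnegrE ?ler0n //.
    by rewrite mulr_ge0 ?subr_ge0 // mulr_ge0 // ltW.
  apply: (@le_trans _ _ (T%:R / kappa * (H - 2) * V)); first by rewrite ler_pM2r.
  have -> : T%:R / kappa * (H - 2) * V = (T%:R * n%:R) ^+ 2 * ((H - 2) * H).
    by rewrite /V; field; rewrite gt_eqF.
  rewrite [in leRHS]exprMn ler_pM2l ?exprn_gt0 ?mulr_gt0 //.
  nra.
have inf : \sum_(j < m) \sum_x influence R T sigma h i w j x ^+ 2 <= V.
  have := influence_sqr occ mE i wd. exact.
(* Stated for any [g] with the same sum of squares as [influence]: a false acceptance is an upper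
   deviation of the correlation, a missed label one of its negative. *)
have tail (g : 'I_m -> 'I_n -> R) (tau : R) : 0 <= tau -> (forall j, g j i = 0) ->
    \sum_j \sum_x g j x ^+ 2 = \sum_(j < m) \sum_x influence R T sigma h i w j x ^+ 2 ->
    #|[set e : signs | tau * W <= correlation g i e]|%:R
      <= #|{: signs}|%:R * expR (- (tau ^+ 2 * Z / 2)).
  move=> tau0 gi gE.
  have := @correlation_tail R m n g i (tau * W) V gi.
  rewrite gE => /(_ inf V0) /(_ _)/le_trans; apply.
    by rewrite mulr_ge0 // ler0n.
  rewrite ler_wpM2l // ler_expR lerN2 exprMn.
  rewrite ler_pdivlMr; last by rewrite mulr_gt0.
  have -> : tau ^+ 2 * Z / 2 * (2 * V) = tau ^+ 2 * (Z * V) by field.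
  by rewrite ler_wpM2l ?sqr_ge0.
have abR : a%:R / b%:R <= 1 :> R by rewrite ler_pdivrMr // mul1r ler_nat.
pose g : 'I_m -> 'I_n -> R := influence R T sigma h i w.
have gi j : g j i = 0 by rewrite /g /influence eqxx andbF.
have corN e : correlation (fun j x => - g j x) i e = - correlation g i e.
  rewrite /correlation -sumrN; apply: eq_bigr => j _.
  by rewrite -sumrN; apply: eq_bigr => x _; rewrite mulNr.
rewrite /wrong; case: (boolP (sigma i == w :> nat)) => siw.
  apply: le_trans (tail (fun j x => - g j x) (1 - a%:R / b%:R) _ _ _); last 3 first.
  - by rewrite subr_ge0.
  - by move=> j; rewrite gi oppr0.
  - by apply: eq_bigr => j _; apply: eq_bigr => x _; rewrite sqrrN.
  rewrite ler_nat; apply/subset_leq_card/fintype.subsetP => e; rewrite !inE (accepts_correlation R).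
  rewrite siw mul1r corN -/W -/g eqb_id -leNgt => h1.
  rewrite -(ler_pM2l bR) mulrN lerNr.
  have -> : - (b%:R * ((1 - a%:R / b%:R) * W)) = a%:R * W - b%:R * W.
    by field; rewrite gt_eqF.
  by rewrite lerBrDl -mulrDr.
apply: le_trans (tail g (a%:R / b%:R) _ gi _); [|by rewrite divr_ge0|by []].
rewrite ler_nat; apply/subset_leq_card/fintype.subsetP => e; rewrite !inE (accepts_correlation R).
rewrite (negbTE siw) mul0r add0r -/W -/g eqbF_neg negbK => /ltW h1.
by rewrite -(ler_pM2l bR) mulrA mulrCA mulfV ?mulr1 // gt_eqF.
Qed.

Variables (K l : R).
Hypothesis l0 : 0 <= l.
Hypothesis K0 : 0 <= K.
Hypothesis labelK : forall w : 'I_d.+1, (0 < w)%N -> #|[set x | sigma x == w :> nat]|%:R <= K.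

Definition decodable (h : hashes) (e : signs) : bool :=
  [forall i : 'I_n, forall w : 'I_d.+1, (0 < w)%N ==>
    (accepts T a b (random_design T h e) sigma (fun x => (h x).+1) i w
       == (sigma i == w :> nat))].

(** The terms stand for an overloaded compartment, a false acceptance and a missed label. The last
    involves only the at most [K] carriers of each label, which makes an asymmetric threshold
    profitable. *)
Definition failure_bound : R :=
  d%:R * L.+1%:R * expR ((expR l - 1) * (K / L.+1%:R) - l * kappa)
  + n%:R * d%:R * expR (- ((a%:R / b%:R) ^+ 2 * Z / 2))
  + d%:R * K * expR (- ((1 - a%:R / b%:R) ^+ 2 * Z / 2)).

Lemma failure_le :
  \sum_(h : hashes) \sum_(e : signs) (~~ decodable h e)%:R
    <= #|{: hashes}|%:R * #|{: signs}|%:R * failure_bound.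
Proof.
set E := #|{: signs}|%:R; set p1 := expR (- ((a%:R / b%:R) ^+ 2 * Z / 2)).
set p2 := expR (- ((1 - a%:R / b%:R) ^+ 2 * Z / 2)).
set p0 := expR ((expR l - 1) * (K / L.+1%:R) - l * kappa).
have sumw (x : R) : \sum_(w < d.+1 | (0 < w)%N) x = d%:R * x.
  by rewrite big_mkcond big_ord_recl /= add0r sumr_const card_ord mulr_natl.
have good h : occupied h ->
    \sum_(e : signs) (~~ decodable h e)%:R <= E * (n%:R * d%:R * p1 + d%:R * K * p2).
  move=> oc.
  apply: (@le_trans _ _ (\sum_(i < n) \sum_(w < d.+1 | (0 < w)%N) #|wrong h i w|%:R)).
    under [leRHS]eq_bigr => i _.
      under eq_bigr => w _ do rewrite -sum1_card natr_sum big_mkcond /=.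
      rewrite exchange_big /=; over.
    rewrite exchange_big /=; apply: ler_sum => e _.
    case: (boolP (decodable h e)) => [_|].
      by apply: sumr_ge0 => i _; apply: sumr_ge0 => w _; case: ifP.
    rewrite negb_forall => /existsP[i]; rewrite negb_forall => /existsP[w].
    rewrite negb_imply => /andP[w0 iw].
    rewrite (bigD1 i) //= (bigD1 w) //= inE iw /= -addrA lerDl addr_ge0 // sumr_ge0 //.
      by move=> ? _; case: ifP.
    by move=> ? _; apply: sumr_ge0 => ? _; case: ifP.
  (* Every pair is charged the false-acceptance bound and carriers the other one in addition, so
     that the latter is counted at most [K] times per label. *)
  apply: (@le_trans _ _ (\sum_(i < n) \sum_(w < d.+1 | (0 < w)%N)
      (E * p1 + (sigma i == w :> nat)%:R * (E * p2)))).
    apply: ler_sum => i _; apply: ler_sum => w w0.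
    have wd : (0 < w <= d)%N by rewrite w0 -ltnS ltn_ord.
    apply: le_trans (wrong_bound i wd oc) _.
    case: eqP => _; rewrite ?mul1r ?mul0r ?addr0 -?/p1 -?/p2 -/E //.
    by rewrite lerDr mulr_ge0 // expR_ge0.
  under eq_bigr => i _ do rewrite big_split /= sumw.
  rewrite big_split /= sumr_const card_ord.
  have -> : E * (n%:R * d%:R * p1 + d%:R * K * p2) = (d%:R * (E * p1)) *+ n + d%:R * (K * (E * p2)).
    by rewrite -mulr_natl; ring.
  rewrite lerD2l.
  rewrite exchange_big /=.
  apply: (@le_trans _ _ (\sum_(w < d.+1 | (0 < w)%N) K * (E * p2))).
    apply: ler_sum => w w0; rewrite -mulr_suml ler_wpM2r //.
      by rewrite mulr_ge0 // expR_ge0.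
    apply: le_trans (labelK w0); rewrite -natr_sum ler_nat -sum1_card [leqRHS]big_mkcond /=.
    by apply: leq_sum => x _; rewrite inE; case: eqP.
  by rewrite sumw.
have bad : \sum_(h : hashes) (~~ occupied h)%:R <= #|{: hashes}|%:R * (d%:R * L.+1%:R * p0).
  apply: (@le_trans _ _ (\sum_(w < d.+1 | (0 < w)%N) \sum_(c < L.+1)
     #|[set h : hashes | kappa <= #|[set x in [set x | sigma x == w :> nat] | h x == c]|%:R]|%:R)).
    under [leRHS]eq_bigr => w _.
      under eq_bigr => c _ do rewrite -sum1_card natr_sum big_mkcond /=.
      rewrite exchange_big /=; over.
    rewrite exchange_big /=; apply: ler_sum => h _.
    case: (boolP (occupied h)) => [_|].
      by apply: sumr_ge0 => i _; apply: sumr_ge0 => w _; case: ifP.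
    rewrite negb_forall => /existsP[w]; rewrite negb_forall => /existsP[c].
    rewrite negb_imply -ltNge => /andP[w0 /ltW wc].
    rewrite (bigD1 w) //= (bigD1 c) //= inE wc -addrA lerDl addr_ge0 // sumr_ge0 //.
      by move=> ? _; case: ifP.
    by move=> ? _; apply: sumr_ge0 => ? _; case: ifP.
  apply: (@le_trans _ _ (\sum_(w < d.+1 | (0 < w)%N) \sum_(c < L.+1) #|{: hashes}|%:R * p0)).
    apply: ler_sum => w w0; apply: ler_sum => c _.
    apply: le_trans (occupancy_tail _ _ _ l0) _.
    rewrite ler_wpM2l // ler_expR lerD2r ler_wpM2l ?ler_pM2r ?invr_gt0 ?ltr0n ?labelK //.
    by rewrite subr_ge0 -expR0 ler_expR.
  rewrite sumw sumr_const card_ord -mulr_natl le_eqVlt; apply/orP; left; apply/eqP; ring.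
apply: (@le_trans _ _ (\sum_(h : hashes) ((~~ occupied h)%:R * E + E * (n%:R * d%:R * p1 + d%:R * K * p2)))).
  have p0' : 0 <= E * (n%:R * d%:R * p1 + d%:R * K * p2).
    by rewrite !(mulr_ge0, addr_ge0) ?expR_ge0.
  apply: ler_sum => h _; case: (boolP (occupied h)) => oc; first by rewrite mul0r add0r good.
  rewrite mul1r; apply: ler_wpDr => //.
  apply: (@le_trans _ _ (\sum_(e : signs) 1)); first by apply: ler_sum => e _; case: (_ e).
  by rewrite sumr_const.
rewrite big_split /= -mulr_suml sumr_const /failure_bound -/p0 -/p1 -/p2.
set X := E * _; set N := #|_|.
have -> : N%:R * E * (d%:R * L.+1%:R * p0 + n%:R * d%:R * p1 + d%:R * K * p2)
    = N%:R * (d%:R * L.+1%:R * p0) * E + X *+ N.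
  by rewrite -[X *+ N]mulr_natl /X; ring.
by rewrite lerD2r ler_wpM2r.
Qed.

End Failure.

(** * The law of the design and the success probability *)

Section Law.
Variables (R : realType) (n m L T : nat).
Local Notation signs := {ffun 'I_m * 'I_n -> bool}.
Local Notation hashes := {ffun 'I_n -> 'I_L.+1}.

Definition design_law (G : design n m) : R :=
  \sum_(h : hashes) \sum_(e : signs) (random_design T h e == G)%:R
    / (#|{: hashes}|%:R * #|{: signs}|%:R).

Lemma card_randomness_gt0 : 0 < #|{: hashes}|%:R * #|{: signs}|%:R :> R.
Proof.
rewrite mulr_gt0 // ltr0n; apply/card_gt0P.
  by exists [ffun=> ord0].
by exists [ffun=> true].
Qed.

Lemma sum_design_law (F : design n m -> R) :
  \sum_G design_law G * F G = \sum_(h : hashes) \sum_(e : signs)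
    F (random_design T h e) / (#|{: hashes}|%:R * #|{: signs}|%:R).
Proof.
rewrite /design_law; under eq_bigr => G _ do rewrite mulr_suml.
rewrite exchange_big /=; apply: eq_bigr => h _.
under eq_bigr => G _ do rewrite mulr_suml.
rewrite exchange_big /=; apply: eq_bigr => e _.
rewrite (bigD1 (random_design T h e)) //= eqxx big1 => [|G /negbTE].
  by rewrite addr0 mul1r mulrC.
by rewrite eq_sym => ->; rewrite !mul0r.
Qed.

Lemma design_law_pmf : is_pmf design_law.
Proof.
have N0 := card_randomness_gt0.
split=> [G|].
  by apply: sumr_ge0 => h _; apply: sumr_ge0 => e _; rewrite divr_ge0 // ltW.
have := sum_design_law (fun=> 1); under eq_bigr do rewrite mulr1.
move=> ->; under eq_bigr => h _ do rewrite sumr_const.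
rewrite sumr_const -mulrnA -[LHS]mulr_natl mulnC natrM div1r mulfV //.
by rewrite gt_eqF.
Qed.

End Law.

Lemma success_probability_le1 (R : realType) (n m d : nat) (k : 'I_d -> nat)
    (P : design n m -> R) A : is_pmf P -> success_probability k P A <= 1.
Proof.
move=> [P0 P1]; rewrite -P1; apply: ler_sum => G _.
apply: (@le_trans _ _ (\sum_(sigma in ground_truths n k) P G * #|ground_truths n k|%:R^-1)).
  by apply: ler_sum => sigma _; apply: ler_piMr; rewrite ?mulr_ge0 ?invr_ge0 //; case: (_ == _).
rewrite sumr_const -[leLHS]mulr_natr -mulrA -[leRHS]mulr1 ler_wpM2l //.
have [->|k0] := eqVneq (#|ground_truths n k|%:R : R) 0; first by rewrite mulr0.
by rewrite mulVf.
Qed.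

Lemma ground_truthP (n d : nat) (k : 'I_d -> nat) sigma (w : 'I_d.+1) :
  sigma \in ground_truths n k -> (0 < w)%N ->
  exists i, #|[set x | sigma x == w :> nat]| = k i.
Proof.
rewrite inE => /forallP ks w0.
case: (unliftP ord0 w) w0 => [i ->|->] // _; exists i.
rewrite -(eqP (ks i)); apply: eq_card => x; rewrite !inE.
by apply/idP/idP => /eqP e; apply/eqP; rewrite e.
Qed.

(** The failure bound holds for each fixed ground truth over the randomness of the design alone, so
    averaging over the nonempty set of ground truths preserves it. *)
Lemma success_probability_ge (R : realType) (n d L P T a b : nat) (k : 'I_d -> nat)
    (kappa Z K l : R) :
  (T <= n)%N -> (0 < T)%N -> (L.+1 < P)%N -> (P <= n)%N -> (a <= b)%N -> (0 < b)%N ->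
  0 < kappa ->
  (forall c, (P - L.+1 <= c)%N -> Z <= T%:R / kappa * (harmonic_sum R c - 2)) ->
  0 <= l -> 0 <= K -> (forall i, (k i)%:R <= K) -> (0 < #|ground_truths n k|)%N ->
  1 - failure_bound n d L a b kappa Z K l
    <= success_probability k (@design_law R n (P * T.+1) L T) (@decode_labels a b n (P * T.+1) d k).
Proof.
move=> Tn T0 LP Pn ab b0 kappa0 ZP l0 K0 kK gt0.
set m := (P * T.+1)%N; set f := failure_bound _ _ _ _ _ _ _ _ _.
have m0 : (0 < m)%N by rewrite muln_gt0 andbT (leq_trans _ LP).
have gR : 0 < #|ground_truths n k|%:R :> R by rewrite ltr0n.
have N0 := card_randomness_gt0 R n m L.
set N := (X in 0 < X) in N0.
apply: (@le_trans _ _ (\sum_(sigma in ground_truths n k) #|ground_truths n k|%:R^-1 * (1 - f))).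
  by rewrite -mulr_suml sumr_const -[X in X * _]mulr_natr mulVf ?mul1r // gt_eqF.
rewrite /success_probability exchange_big /=; apply: ler_sum => sigma sg.
under [leRHS]eq_bigr => G _ do rewrite [design_law _ _ _ _ * _]mulrC -mulrA.
rewrite -mulr_sumr ler_wpM2l ?invr_ge0 ?ler0n // sum_design_law.
have labelK (w : 'I_d.+1) : (0 < w)%N -> #|[set x | sigma x == w :> nat]|%:R <= K.
  by move=> w0; have [i ->] := ground_truthP sg w0.
have := @failure_le R n d m L P T a b sigma T0 erefl LP Pn ab b0 kappa Z kappa0 ZP K l l0 K0 labelK.
rewrite -/f -/N => fl.
apply: (@le_trans _ _ (\sum_(h : {ffun 'I_n -> 'I_L.+1}) \sum_(e : {ffun 'I_m * 'I_n -> bool})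
   (1 - (~~ decodable T a b sigma h e)%:R) / N)); last first.
  apply: ler_sum => h _; apply: ler_sum => e _.
  rewrite ler_pM2r ?invr_gt0 //.
  case: (boolP (decodable T a b sigma h e)) => [/forallP dec|_]; last by rewrite subrr; case: (_ == _).
  rewrite subr0 (_ : decode_labels _ _ _ _ _ = sigma) ?eqxx //.
  apply/ffunP => i; rewrite ffunE (@decoder_correct n m d T a b k _ sigma (fun x => (h x).+1)) //.
  - exact: inord_val.
  - exact: layout_random.
  - move=> x w /andP[w0 wd].
    have /forallP/(_ (Ordinal (wd : w < d.+1)%N))/implyP/(_ w0) := dec x.
    by move=> /eqP.
under [leRHS]eq_bigr => h _ do rewrite -mulr_suml sumrB sumr_const.
rewrite -mulr_suml ler_pdivlMr // sumrB sumr_const.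
rewrite mulrBl mul1r; apply: lerB; last by rewrite mulrC.
by rewrite /N -[leRHS]mulr_natr mulrC.
Qed.

(** The success probability is 0 when no ground truth exists, so one is exhibited: the labels listed
    with multiplicity, filled up with 0. *)
Lemma ground_truths_gt0 (n d : nat) (k : 'I_d -> nat) :
  (\sum_i k i <= n)%N -> (0 < #|ground_truths n k|)%N.
Proof.
move=> kn.
pose s : seq 'I_d.+1 := flatten [seq nseq (k i) (lift ord0 i) | i <- enum 'I_d].
have sz : size s = (\sum_i k i)%N.
  rewrite /s size_flatten /shape -map_comp sumnE big_map -big_enum /=.
  by apply: eq_bigr => i _; rewrite size_nseq.
have szt : size (s ++ nseq (n - size s) ord0) == n.
  by rewrite size_cat size_nseq subnKC // sz.
pose t := Tuple szt.
apply/card_gt0P; exists [ffun x => tnth t x]; rewrite inE; apply/forallP => i; apply/eqP.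
have -> : #|[set x | [ffun x => tnth t x] x == lift ord0 i]| = count_mem (lift ord0 i) t.
  rewrite -(map_tnth_enum t) count_map cardE -size_filter /enum_mem.
  rewrite -filter_predI; congr size; apply: eq_filter => x /=.
  by rewrite inE ffunE andbT.
rewrite count_cat count_nseq /= ?eq_liftF ?mul0n addn0 /s count_flatten sumnE !big_map.
rewrite -enumT big_enum /= (bigD1 i) //= count_nseq /= eqxx mul1n big1 ?addn0 // => j /negbTE ji.
by rewrite count_nseq /= (inj_eq lift_inj) ji.
Qed.

Lemma ln_harmonic_sum (R : realType) (c : nat) : ln c.+1%:R <= harmonic_sum R c.
Proof.
elim: c => [|c IH]; first by rewrite ln1 /harmonic_sum big_ord0.
rewrite /harmonic_sum big_ord_recr /= -/(harmonic_sum R c).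
have c0 : 0 < c.+1%:R :> R by rewrite ltr0n.
have -> : c.+2%:R = c.+1%:R * (1 + c.+1%:R^-1) :> R.
  by rewrite mulrDr mulr1 mulfV ?gt_eqF // natr1.
have i0 : 0 < c.+1%:R^-1 :> R by rewrite invr_gt0.
rewrite lnM ?posrE // ?addr_gt0 //; apply: lerD => //.
by apply: le_ln1Dx; apply: lt_trans i0.
Qed.

Local Open Scope classical_set_scope.

Lemma near_ln (R : realType) (A : R) : \forall n \near \oo, A <= ln (n%:R : R).
Proof.
exists (Num.truncn (expR A)).+1 => // n /= hn.
have h : expR A <= n%:R.
  by apply: ltW; rewrite -truncn_lt_nat ?expR_ge0.
rewrite -[A]expRK ler_ln ?posrE ?expR_gt0 //.
exact: lt_le_trans (expR_gt0 _) h.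
Qed.

Lemma rational_between (R : realType) (x y : R) : 0 <= x -> x < y -> y <= 1 ->
  exists a b : nat, [/\ (0 < b)%N, (a <= b)%N, x < a%:R / b%:R & a%:R / b%:R < y].
Proof.
move=> x0 xy y1.
have w0 : 0 < y - x by rewrite subr_gt0.
pose b := (Num.truncn (y - x)^-1).+1.
have bR : 0 < b%:R :> R by rewrite ltr0n.
have wb : 1 < (y - x) * b%:R.
  by rewrite -ltr_pdivrMl // mulr1 /b truncnS_gt.
pose a := (Num.truncn (x * b%:R)).+1.
have h1 : x * b%:R < a%:R by rewrite truncnS_gt.
have h2 : a%:R <= x * b%:R + 1.
  by rewrite /a -natr1 lerD2r truncn_le // mulr_ge0 // ltW.
have lt : a%:R / b%:R < y.
  rewrite ltr_pdivrMr //; nra.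
exists a, b; split => //; last by rewrite ltr_pdivlMr.
rewrite -(ler_nat R) -[b%:R]mul1r -ler_pdivrMr //.
exact: le_trans (ltW lt) y1.
Qed.

(** With g = sqrt (C / 2) and tau = a / b the two conditions read tau g > 1 and (1 - tau) g > s, so
    tau must lie between 1 / g and 1 - s / g. This interval is nonempty because g > 1 + s; tau is
    rational because [a] and [b] are program literals. *)
Lemma threshold_exists (R : realType) (s C : R) : 0 <= s -> 2 * (1 + s) ^+ 2 < C ->
  exists a b : nat, [/\ (0 < b)%N, (a <= b)%N, 1 < (a%:R / b%:R) ^+ 2 * C / 2
    & s ^+ 2 < (1 - a%:R / b%:R) ^+ 2 * C / 2].
Proof.
move=> s0 sC; pose g := Num.sqrt (C / 2).
have s1 : 0 < 1 + s by lra.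
have C0 : 0 <= C / 2 by nra.
have gg : g ^+ 2 = C / 2 by rewrite sqr_sqrtr.
have g0 : 0 <= g by exact: sqrtr_ge0.
have gs : 1 + s < g by nra.
have gp : 0 < g by lra.
have [||| a [b [b0 ab t1 t2]]] := @rational_between R g^-1 (1 - s / g).
- by rewrite invr_ge0.
- by rewrite ltrBrDr -[X in X + _]mul1r -mulrDl ltr_pdivrMr // mul1r.
- by rewrite gerBl divr_ge0.
exists a, b; split => //.
- have : 1 < a%:R / b%:R * g by rewrite -ltr_pdivrMr // mul1r.
  have -> : (a%:R / b%:R) ^+ 2 * C / 2 = (a%:R / b%:R * g) ^+ 2.
    by rewrite [RHS]exprMn gg mulrA.
  move: (_ * g) => u; nra.
- have : s < (1 - a%:R / b%:R) * g.
    by rewrite -ltr_pdivrMr // ltrBrDr addrC -ltrBrDr.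
  have -> : (1 - a%:R / b%:R) ^+ 2 * C / 2 = ((1 - a%:R / b%:R) * g) ^+ 2.
    by rewrite [RHS]exprMn gg mulrA.
  move: (_ * g) => u; nra.
Qed.

(** * Choice of the parameters *)

(* The number of occurrences of a label per compartment: above ln n, for the
   union bound over the compartments, but of size n^o(1), so that the number of
   positions is still n^(theta - o(1)). *)
Definition mean_load (R : realType) (n : nat) : nat := Num.truncn (ln (n%:R : R) ^+ 2).

Lemma ln_nat_gt0 (R : realType) (n : nat) : 0 < ln (n%:R : R) -> (0 < n)%N.
Proof. by case: n => //; rewrite ln0 // ltxx. Qed.

Lemma positions_bound (S B : nat) : (2 < S)%N -> (4 <= B)%N ->
  (S * B + S + 2 <= S * (B * B))%N.
Proof.
move=> S2 B4.
have SB : (4 * S <= S * B)%N by rewrite mulnC leq_mul2l B4 orbT.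
have : (4 * (S * B) <= S * (B * B))%N by rewrite (mulnA S) (mulnC (S * B)%N) leq_mul2r B4 orbT.
lia.
Qed.

(** Applied to S, B, T, C1 and rho. The product has leading term c s u^2; the last hypothesis lets
    the slack c r s u^2 absorb the rest. *)
Lemma pools_bound (R : realType) (s u t c r : R) :
  2 < s -> 4 <= u -> 0 < c -> t <= c * u -> 4 + 3 * c <= u * (c * r) ->
  (s * u + s + 2) * (t + 1) <= c * (1 + r) * (s * (u * u)).
Proof.
move=> s2 u4 c0 tc h.
have su : 0 <= s * u by rewrite mulr_ge0 //; lra.
apply: (@le_trans _ _ ((s * u + s + 2) * (c * u + 1))).
  by apply: ler_wpM2l; rewrite ?lerD2r //; lra.
have h1 : s <= s * u by rewrite ler_peMr //; lra.
have h2 : 2 <= s * u by lra.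
have cu : 0 <= c * u by rewrite mulr_ge0 //; lra.
have h3 : 2 * (c * u) <= s * (c * u) by rewrite ler_wpM2r //; lra.
have h4 := ler_wpM2l su h.
have h5 : 0 <= c * (s * u) by rewrite mulr_ge0 // ltW.
lra.
Qed.
(** Keeps the mean load, rounding included, below (1 + rho / 3) B; the gap to the cap (1 + rho) B
    feeds the Chernoff bound. *)
Lemma load_bound (R : realType) (s u r : R) : 3 <= r * s -> 0 < u -> 0 < r ->
  (s + 1) * (u * u) <= (1 + r / 3) * u * (s * u + 1).
Proof.
move=> h u0 r0.
have h1 := ler_wpM2r (mulr_ge0 (ltW u0) (ltW u0)) h.
have h2 : 0 <= r * u by rewrite mulr_ge0 // ltW.
lra.
Qed.
Lemma rate_bound (R : realType) (c u t r : R) : 0 < c -> 0 < r -> 0 < u ->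
  c * u < t + 1 -> 1 + r <= u * (c * r) -> c / (1 + r) ^+ 2 <= t / ((1 + r) * u).
Proof.
move=> c0 r0 u0 ct h.
have r1 : 0 < 1 + r by lra.
rewrite ler_pdivlMr ?mulr_gt0 //.
have -> : c / (1 + r) ^+ 2 * ((1 + r) * u) = c * u / (1 + r) by field; rewrite gt_eqF.
rewrite ler_pdivrMr //.
have : 0 < r * (t + 1 - c * u) by rewrite mulr_gt0 // subr_gt0.
lra.
Qed.

Section Asymptotics.
Variables (R : realType) (theta rho C1 : R).
Hypothesis theta01 : 0 < theta < 1.
Hypothesis rho01 : 0 < rho <= 1.
Hypothesis C10 : 0 < C1.

Definition lookahead (n : nat) : nat :=
  sparsity_count theta n %/ (mean_load R n * mean_load R n).
Definition compartments (n : nat) : nat := lookahead n * mean_load R n.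
(** Positions start at 0 and the L + 1 compartments occupy 1, ..., L + 1, so [lookahead] positions
    follow even the last compartment. *)
Definition positions (n : nat) : nat := compartments n + lookahead n + 2.
Definition tests_per_position (n : nat) : nat := Num.truncn (C1 * (mean_load R n)%:R).
Definition pools (n : nat) : nat := positions n * (tests_per_position n).+1.
(** Each factor 1 + rho pays for one loss: the load cap (1 + rho) B, the rounding of T, the exponent
    theta / (1 + rho) of the lookahead, and the 2 subtracted from the harmonic sum. *)
Definition snr : R := C1 * theta / (1 + rho) ^+ 4.

Lemma positions_gt n : ((compartments n).+1 < positions n)%N.
Proof. by rewrite /positions addn2 !ltnS leq_addr. Qed.

Lemma sparsity_count_le (t : R) n : (0 < n)%N ->
  (sparsity_count t n)%:R <= expR (t * ln n%:R).
Proof.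
move=> n0; have nR : 0 < n%:R :> R by rewrite ltr0n.
apply: (@le_trans _ _ (n%:R `^ t)); first by rewrite truncn_le // powR_ge0.
by rewrite /powR gt_eqF.
Qed.

Lemma sparsity_count_gt (t : R) n : (0 < n)%N ->
  expR (t * ln n%:R) < (sparsity_count t n)%:R + 1.
Proof.
move=> n0; have nR : 0 < n%:R :> R by rewrite ltr0n.
rewrite natr1; apply: le_lt_trans (truncnS_gt _).
by rewrite /powR gt_eqF.
Qed.

Lemma lookahead_near : \forall n \near \oo,
  expR (theta / (1 + rho) * ln n%:R) < (lookahead n)%:R + 1.
Proof.
have /andP[t0 t1] := theta01; have /andP[r0 r1] := rho01.
set theta' := theta / (1 + rho); set eta := theta - theta'.
have r10 : 0 < 1 + rho by lra.
have tt : theta' < theta by rewrite /theta' ltr_pdivrMr // ltr_pMr //; lra.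
have e0 : 0 < eta by rewrite subr_gt0.
near=> n.
have x1 : 1 <= ln (n%:R : R) by near: n; exact: near_ln.
(* 120 is 5!: from here on the term (eta x)^5 / 5! of the exponential series is at least x^4. *)
have x2 : 120 / eta ^+ 5 <= ln (n%:R : R) by near: n; exact: near_ln.
have n0 : (0 < n)%N by apply: (@ln_nat_gt0 R); apply: lt_le_trans x1.
have := sparsity_count_gt theta n0.
have : (mean_load R n)%:R <= ln (n%:R : R) ^+ 2 by rewrite truncn_le ?sqr_ge0.
rewrite /lookahead; set x := ln _ in x1 x2 *; set B := mean_load R n; set k := sparsity_count _ _.
move=> Bx kx.
have x0 : 0 <= x by lra.
have B0 : (0 < B)%N by rewrite /B /mean_load truncn_gt0 -/x expr_ge1.
have kS : (k < (k %/ (B * B)).+1 * (B * B))%N by rewrite -ltn_divLR ?ltnS // muln_gt0 B0.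
have {}kS : k%:R < ((k %/ (B * B))%N%:R + 1) * (B%:R * B%:R) :> R.
  by rewrite natr1 -!natrM ltr_nat.
set S : R := (k %/ (B * B))%N%:R in kS *.
have S0 : 0 <= S by rewrite /S.
have B0' : 0 <= B%:R :> R by [].
have BB : B%:R * B%:R <= x ^+ 4 :> R.
  by rewrite (_ : x ^+ 4 = x ^+ 2 * x ^+ 2) ?ler_pM // -exprD.
have ex : expR (theta * x) = expR (theta' * x) * expR (eta * x).
  by rewrite -expRD; congr expR; rewrite /eta; ring.
have e1 : 1 <= expR (theta' * x).
  by rewrite -expR0 ler_expR mulr_ge0 // divr_ge0 // ltW.
(* x^4 bounds the divisor B^2; the extra 1 compensates the floor in k. *)
have e2 : 1 + x ^+ 4 <= expR (eta * x).
  apply: le_trans (expR_ge1Dxn 4 _); last by rewrite mulr_ge0 // ltW.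
  rewrite lerD2l.
  have -> : (eta * x) ^+ 5 / 5`!%:R = x ^+ 4 * ((eta ^+ 5 * x) / 120).
    by rewrite (_ : 5`! = 120)%N //; field.
  rewrite ler_peMr ?exprn_ge0 // ler_pdivlMr // mul1r.
  by rewrite mulrC -ler_pdivrMr // exprn_gt0.
have x40 : 0 < x ^+ 4 by rewrite exprn_gt0 //; lra.
rewrite -(ltr_pM2r x40).
apply: lt_le_trans (_ : (S + 1) * (B%:R * B%:R) <= _); last by rewrite ler_wpM2l // addr_ge0.
apply: le_lt_trans kS.
have : expR (theta' * x) * (1 + x ^+ 4) <= expR (theta * x).
  by rewrite ex ler_wpM2l // expR_ge0.
rewrite mulrDr mulr1; move: kx; set y := expR (theta * x); lra.
Unshelve. all: by end_near. Qed.

Definition parameters_ok (n : nat) : Prop :=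
  let B := mean_load R n in let k := sparsity_count theta n in
  let L := compartments n in let P := positions n in
  let T := tests_per_position n in
  [/\ ((pools n)%:R <= C1 * (1 + rho) * k%:R), (P <= n)%N, (T <= n)%N, (0 < T)%N &
   [/\ forall c, (P - L.+1 <= c)%N ->
        snr * ln n%:R <= T%:R / ((1 + rho) * B%:R) * (harmonic_sum R c - 2),
       0 < (1 + rho) * B%:R,
       k%:R / L.+1%:R <= (1 + rho / 3) * B%:R & ln n%:R ^+ 2 / 2 <= B%:R :> R]].

Lemma parameters_near : \forall n \near \oo, parameters_ok n.
Proof.
have /andP[t0 t1] := theta01; have /andP[r0 r1] := rho01.
have r10 : 0 < 1 + rho by lra.
set theta' := theta / (1 + rho); have t'0 : 0 < theta' by rewrite divr_gt0.
pose C3 := C1 / (1 + rho) ^+ 2.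
have C30 : 0 < C3 by rewrite divr_gt0 // exprn_gt0.
have snrE : C3 * theta' = snr * (1 + rho) by rewrite /C3 /theta' /snr; field; rewrite gt_eqF.
have snr0 : 0 < snr by rewrite !(divr_gt0, mulr_gt0, exprn_gt0).
near=> n; rewrite /parameters_ok.
set B := mean_load R n; set k := sparsity_count theta n; set L := compartments n.
set P := positions n; set T := tests_per_position n.
have Sx : expR (theta' * ln n%:R) < (lookahead n)%:R + 1 by near: n; exact: lookahead_near.
have x1 : 2 <= ln (n%:R : R) by near: n; exact: near_ln.
(* One positive term for each of [b1] to [b5]; the 5 also covers the 1 lost in rounding B. *)
have x2 : 5 + C1 + (4 + 3 * C1) / (C1 * rho) + C1^-1 + (1 + rho) / (C1 * rho) <= ln (n%:R : R)
  by near: n; exact: near_ln.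
have x3 : 2 * C3 / (snr * rho) <= ln (n%:R : R) by near: n; exact: near_ln.
have x4 : 3 / (rho * theta') + theta'^-1 * 2 <= ln (n%:R : R) by near: n; exact: near_ln.
have n0 : (0 < n)%N by apply: (@ln_nat_gt0 R); apply: lt_le_trans x1.
have Bx : B%:R <= ln (n%:R : R) ^+ 2 by rewrite truncn_le ?sqr_ge0.
have xB : ln (n%:R : R) ^+ 2 < B%:R + 1 by rewrite natr1 truncnS_gt.
have SE : lookahead n = (k %/ (B * B))%N by [].
have kn : (k <= n)%N.
  rewrite -(ler_nat R); apply: le_trans (sparsity_count_le theta n0) _.
  rewrite -[leRHS]lnK ?posrE ?ltr0n // ler_expR ler_piMl //; first by apply: le_trans x1.
  by lra.
have LE : L = (lookahead n * B)%N by [].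
have PE : P = (L + lookahead n + 2)%N by [].
have TE : T = Num.truncn (C1 * B%:R) by [].
have poolsE : pools n = (P * T.+1)%N by [].
move: (lookahead n) Sx SE LE PE => S Sx SE LE PE.
set x := ln _ in Sx x1 x2 x3 x4 Bx xB *.
have C1p := C10; have CR : 0 < C1 * rho by rewrite mulr_gt0.
have [y yE] : {y | y = (4 + 3 * C1) / (C1 * rho)} by eexists.
have [z zE] : {z | z = (1 + rho) / (C1 * rho)} by eexists.
have [w wE] : {w | w = C1^-1} by eexists.
rewrite -yE -zE -wE in x2.
have y0 : 0 < y by rewrite yE divr_gt0 //; lra.
have z0 : 0 < z by rewrite zE divr_gt0.
have w0 : 0 < w by rewrite wE invr_gt0.
have xx : x <= x ^+ 2 by rewrite expr2 ler_peMl //; lra.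
have b1 : 4 <= B%:R :> R by lra.
have b2 : 4 + 3 * C1 <= B%:R * (C1 * rho) by rewrite -ler_pdivrMr // -yE; lra.
have b3 : 1 <= C1 * B%:R by rewrite mulrC -ler_pdivrMr // div1r -wE; lra.
have b4 : 1 + rho <= B%:R * (C1 * rho) by rewrite -ler_pdivrMr // -zE; lra.
have b5 : C1 <= B%:R by lra.
have B4 : (4 <= B)%N by rewrite -(ler_nat R).
have B0 : (0 < B)%N by apply: leq_trans B4.
have s1 : theta' * x < S%:R by move: Sx (expR_ge1Dx (theta' * x)); lra.
have s2 : 3 / rho + 2 <= theta' * x.
  rewrite [leRHS]mulrC -ler_pdivrMr // mulrDl; apply: le_trans x4.
  by rewrite -mulrA -invfM [2 * _]mulrC.
have r3 : 0 < 3 / rho by rewrite divr_gt0.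
have s3 : 2 < S%:R :> R by lra.
have s4 : 3 <= rho * S%:R by rewrite mulrC -ler_pdivrMr //; lra.
have S2 : (2 < S)%N by rewrite -(ltr_nat R).
have kS : (S * (B * B) <= k)%N by rewrite SE leq_trunc_div.
have kS' : (k < S.+1 * (B * B))%N by rewrite SE -ltn_divLR ?ltnS // muln_gt0 B0.
have T1 : T%:R <= C1 * B%:R by rewrite TE truncn_le mulr_ge0 // ltW.
have T2 : C1 * B%:R < T%:R + 1 by rewrite TE natr1 truncnS_gt.
have kR : S%:R * (B%:R * B%:R) <= k%:R :> R by rewrite -!natrM ler_nat.
have kR' : k%:R <= (S%:R + 1) * (B%:R * B%:R) :> R by rewrite natr1 -!natrM ler_nat ltnW.
have Br0 : 0 < B%:R :> R by lra.
split.
- rewrite poolsE PE LE natrM !natrD natrM -[T.+1%:R]natr1.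
  apply: le_trans (pools_bound s3 b1 C1p T1 b2) _.
  by rewrite ler_wpM2l // mulr_ge0 // ltW.
- by rewrite PE LE; apply: leq_trans kn; apply: leq_trans kS; exact: positions_bound.
- apply: leq_trans kn; apply: leq_trans kS.
  have TBB : (T <= B * B)%N.
    by rewrite -(ler_nat R) natrM; apply: le_trans T1 _; rewrite ler_wpM2r // ltW.
  by apply: leq_trans TBB _; rewrite leq_pmull // (ltn_trans _ S2).
- by rewrite TE truncn_gt0.
split.
- move=> c; rewrite PE addn2 subSS -addnS addKn => Sc.
  have H : theta' * x < harmonic_sum R c.
    apply: lt_le_trans (ln_harmonic_sum R c).
    rewrite -ltr_expR lnK ?posrE ?ltr0n //; apply: lt_le_trans Sx _.
    by rewrite natr1 ler_nat ltnS ltnW.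
  have TC : C3 <= T%:R / ((1 + rho) * B%:R) by exact: rate_bound.
  (* By [x3] the loss 2 C3 is at most rho snr x, the spare part of C3 theta' x = (1 + rho) snr x. *)
  apply: (@le_trans _ _ (C3 * (theta' * x - 2))).
    have x3' : 2 * C3 <= x * (snr * rho) by rewrite -(ler_pdivrMr _ _ (mulr_gt0 snr0 r0)).
    by rewrite mulrBr mulrA snrE; lra.
  by apply: ler_pM => //; lra.
- by rewrite mulr_gt0.
- rewrite ler_pdivrMr ?ltr0n // LE -[(S * B).+1%:R]natr1 natrM; apply: le_trans kR' _.
  exact: load_bound.
- have : 2 <= x ^+ 2 by apply: le_trans x1 xx.
  lra.
Unshelve. all: by end_near. Qed.

End Asymptotics.

Lemma decay_near (R : realType) (D beta eta : R) : 0 <= D -> 0 < beta -> 0 < eta ->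
  \forall n \near \oo, D * expR (- (beta * ln n%:R)) <= eta.
Proof.
move=> D0 b0 e0; near=> n.
have x0 : 0 <= ln (n%:R : R) by near: n; exact: near_ln.
have x1 : D / (eta * beta) <= ln (n%:R : R) by near: n; exact: near_ln.
rewrite expRN ler_pdivrMr ?expR_gt0 //.
have h : D <= eta * (beta * ln n%:R).
  by rewrite mulrA mulrC -ler_pdivrMr // mulr_gt0.
apply: le_trans h _; rewrite ler_wpM2l //; first exact: ltW.
by apply: le_trans (expR_ge1Dx _); rewrite lerDr.
Unshelve. all: by end_near. Qed.

Lemma failure_near (R : realType) (theta rho C1 : R) (d a b : nat) (eta : R) :
  0 < theta < 1 -> 0 < rho <= 1 -> 0 < C1 ->
  1 < (a%:R / b%:R) ^+ 2 * snr theta rho C1 / 2 ->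
  theta < (1 - a%:R / b%:R) ^+ 2 * snr theta rho C1 / 2 -> 0 < eta ->
  \forall n \near \oo,
    failure_bound n d (compartments theta n) a b ((1 + rho) * (mean_load R n)%:R)
      (snr theta rho C1 * ln n%:R) (sparsity_count theta n)%:R (rho / 3 / (1 + rho / 3)) <= eta.
Proof.
move=> t01 r01 C10 ht1 ht2 e0; have /andP[r0 r1] := r01; have /andP[t0 t1] := t01.
rewrite /failure_bound; set q := snr _ _ _ in ht1 ht2 *; set tau := a%:R / b%:R in ht1 ht2 *.
clearbody q tau; set l := _ / (1 + rho / 3).
have e3 : 0 < eta / 3 by lra.
have u0 : 0 < 1 + rho / 3 by lra.
have lE : l * (1 + rho / 3) = rho / 3 by rewrite /l -mulrA mulVf ?mulr1 // gt_eqF.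
have l1 : 1 - l = (1 + rho / 3)^-1.
  by rewrite /l; field; rewrite gt_eqF //; lra.
have l0 : 0 <= l by rewrite divr_ge0 //; lra.
clearbody l.
(* [l] is u / (1 + u) with u = rho / 3, so e^(-l) >= 1 - l = 1 / (1 + u) gives e^l <= 1 + u without
   logarithms. *)
have el : expR l - 1 <= rho / 3.
  have := expR_ge1Dx (- l); rewrite l1 expRN lef_pV2 ?posrE ?expR_gt0 //; lra.
(* The Chernoff exponent is at most - gamma B. Positivity amounts to (1 + u)^2 < 1 + 3u, true for 0
   < u < 1. *)
pose gamma := l * (1 + rho) - rho / 3 * (1 + rho / 3).
have g0 : 0 < gamma.
  rewrite subr_gt0 -(ltr_pM2r u0) [ltRHS]mulrAC lE -[ltLHS]mulrA ltr_pM2l; last by lra.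
  nra.
have b1 : 0 < tau ^+ 2 * q / 2 - 1 by lra.
have b2 : 0 < (1 - tau) ^+ 2 * q / 2 - theta by lra.
near=> n.
have p0 : d%:R * expR (- (1 * ln n%:R)) <= eta / 3.
  by near: n; apply: decay_near.
have p1 : d%:R * expR (- ((tau ^+ 2 * q / 2 - 1) * ln n%:R)) <= eta / 3.
  by near: n; apply: decay_near.
have p2 : d%:R * expR (- (((1 - tau) ^+ 2 * q / 2 - theta) * ln n%:R)) <= eta / 3.
  by near: n; apply: decay_near.
have x1 : 2 <= ln (n%:R : R) by near: n; exact: near_ln.
(* Since B >= x^2 / 2, this makes gamma B at least 2x, so a factor e^(-x) survives the union over at
   most n compartments. *)
have x2 : 4 / gamma <= ln (n%:R : R) by near: n; exact: near_ln.
have [_ Pn _ _ [_ _ hk hB]] : parameters_ok theta rho C1 n.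
  by near: n; exact: parameters_near.
have n0 : (0 < n)%N by apply: (@ln_nat_gt0 R); apply: lt_le_trans x1.
have kx := sparsity_count_le theta n0.
have nx : n%:R = expR (ln n%:R) :> R by rewrite lnK // posrE ltr0n.
have Ln : ((compartments theta n).+1 <= n)%N.
  by apply: leq_trans Pn; apply/ltnW/positions_gt.
set x := ln _ in p0 p1 p2 x1 x2 hB kx nx *.
set B := (mean_load R n)%:R in hk hB *.
set L := compartments _ _ in Ln hk *.
set k : R := (sparsity_count _ _)%:R in hk kx *.
have LR : L.+1%:R <= expR x by rewrite -nx ler_nat.
rewrite (_ : eta = eta / 3 + eta / 3 + eta / 3); last by lra.
apply: lerD; first apply: lerD.
- apply: le_trans p0; rewrite -[leLHS]mulrA ler_wpM2l //.
  apply: (@le_trans _ _ (expR x * expR (- gamma * B))).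
    apply: ler_pM; rewrite ?expR_ge0 // ler_expR.
    have kL : 0 <= k / L.+1%:R by rewrite divr_ge0 // ler0n.
    have : (expR l - 1) * (k / L.+1%:R) <= rho / 3 * ((1 + rho / 3) * B).
      by apply: ler_pM => //; rewrite subr_ge0 -expR0 ler_expR.
    rewrite /gamma; move: (_ * (k / _)) => v; lra.
  rewrite -expRD ler_expR mul1r.
  have h1 : 4 <= x * gamma by rewrite -ler_pdivrMr.
  have h2 : gamma * (x ^+ 2 / 2) <= gamma * B by rewrite ler_wpM2l // ltW.
  nra.
- apply: le_trans p1; rewrite [n%:R * _]mulrC -[leLHS]mulrA ler_wpM2l //.
  rewrite nx -expRD ler_expR; lra.
- apply: le_trans p2; rewrite -[leLHS]mulrA ler_wpM2l //.
  apply: (@le_trans _ _ (expR (theta * x) * expR (- ((1 - tau) ^+ 2 * (q * x) / 2)))).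
    by rewrite ler_wpM2r // expR_ge0.
  rewrite -expRD ler_expR; lra.
Unshelve. all: by end_near. Qed.

Local Open Scope ring_scope.

Theorem corollary1p2 (R : realType) (d : nat) (d_ge1 : (1 <= d)%N)
  (thetas : 'I_d -> R) (thetas01 : forall i, 0 < thetas i < 1)
  (theta : R) (theta_max : theta = \big[Num.max/0]_(i < d) thetas i)
  (delta : R) (delta_gt0 : 0 < delta) :
  let k (n : nat) (i : 'I_d) := sparsity_count (thetas i) n in
  exists (m : nat -> nat)
         (P : forall n, design n (m n) -> R)
         (A : forall n, design n (m n) -> histograms (m n) d -> labelling n d),
    [/\ forall n, (m n)%:R <= (1 + delta)
          * ((1 + Num.sqrt theta) / (1 - Num.sqrt theta)) * m_QGT_inf theta n,
        forall n, is_pmf (P n),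
        polynomial_time k A
      & success_probability (k n) (P n) (A n) @[n --> \oo] --> (1 : R)].
Proof.
move=> k.
have thetas_le i : thetas i <= theta by rewrite theta_max le_bigmax_cond.
have /andP[t0 _] := thetas01 (Ordinal d_ge1).
have theta0 : 0 < theta by apply: lt_le_trans t0 (thetas_le _).
have theta1 : theta < 1.
  by rewrite theta_max; apply/bigmax_ltP; split => // i _; have /andP[] := thetas01 i.
set s := Num.sqrt theta.
have s0 : 0 < s by rewrite sqrtr_gt0.
have ss : s ^+ 2 = theta by rewrite sqr_sqrtr // ltW.
have s1 : s < 1 by nra.
(* The pool budget per unit of k: with theta = s^2, the product of 2 (1 - s^2) / s^2 and (1 + s) /
   (1 - s) is 2 (1 + s)^2 / theta. *)
pose C := (1 + delta) * (2 * (1 + s) ^+ 2 / theta).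
have C0 : 0 < C by rewrite mulr_gt0 ?divr_gt0 ?mulr_gt0 ?exprn_gt0 //; lra.
have CE n : (1 + delta) * ((1 + s) / (1 - s)) * m_QGT_inf theta n
    = C * (sparsity_count theta n)%:R.
  rewrite /m_QGT_inf /C -ss; field.
  by rewrite !gt_eqF //; lra.
(* Five factors 1 + rho are lost, four in [snr] and one in [C1]; (1 + rho)^5 <= 1 + 31 rho for rho
   <= 1, which the 32 keeps below 1 + delta. *)
pose rho := Num.min 1 delta / 32.
have [m1 md m0] : [/\ Num.min 1 delta <= 1, Num.min 1 delta <= delta & 0 < Num.min 1 delta].
  by rewrite !ge_min !lexx orbT lt_min ltr01.
have r01 : 0 < rho <= 1 by rewrite /rho; apply/andP; split; lra.
have r10 : 0 < 1 + rho by case/andP: r01 => *; lra.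
pose C1 := C / (1 + rho).
have C10 : 0 < C1 by rewrite divr_gt0.
have snrE : snr theta rho C1 = 2 * (1 + s) ^+ 2 * ((1 + delta) / (1 + rho) ^+ 5).
  by rewrite /snr /C1 /C; field; rewrite !gt_eqF.
have rd : 1 < (1 + delta) / (1 + rho) ^+ 5.
  rewrite ltr_pdivlMr ?exprn_gt0 // mul1r.
  have h : (1 + rho) ^+ 5 <= 1 + 31 * rho.
    case/andP: r01 => r0 r1.
    have rj j : rho ^+ j.+1 <= rho by rewrite exprS ler_piMr ?exprn_ile1 // ltW.
    have := rj 1%N; have := rj 2%N; have := rj 3%N; have := rj 4%N.
    have -> : (1 + rho) ^+ 5 = 1 + 5 * rho + 10 * rho ^+ 2 + 10 * rho ^+ 3 + 5 * rho ^+ 4 + rho ^+ 5.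
      by ring.
    lra.
  by apply: le_lt_trans h _; rewrite /rho; lra.
have snrC : 2 * (1 + s) ^+ 2 < snr theta rho C1.
  by rewrite snrE ltr_pMr // mulr_gt0 ?exprn_gt0 //; lra.
have [a [b [b0 ab t1 t2]]] := threshold_exists (ltW s0) snrC.
rewrite ss in t2.
have theta01 : 0 < theta < 1 by rewrite theta0.
(* The bound on the number of pools is demanded for every n but established only for large n; where
   it fails, no pool is used at all. *)
pose ok n := ((pools theta C1 n)%:R <= C * (sparsity_count theta n)%:R :> R).
pose m n := if ok n then pools theta C1 n else 0%N.
have mC n : (m n)%:R <= C * (sparsity_count theta n)%:R.
  by rewrite /m; case: ifP => //; rewrite mulr_ge0 // ltW.
exists m, (fun n => @design_law R n (m n) (compartments theta n) (tests_per_position C1 n)),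
  (fun n => @decode_labels a b n (m n) d (k n)).
split.
- by move=> n; rewrite CE.
- by move=> n; exact: design_law_pmf.
- apply: (@polynomial_time_decode a b d (Num.truncn C).+1) => n.
  rewrite -(ler_nat R) natrM; apply: le_trans (mC n) _.
  apply: ler_pM => //; [exact: ltW|exact/ltW/truncnS_gt|].
  case: (posnP n) => [->|n0].
    by rewrite /sparsity_count powR0 ?truncn0 // gt_eqF.
  apply: le_trans (sparsity_count_le theta n0) _.
  have nR : 1 <= n%:R :> R by rewrite ler1n.
  rewrite -[leRHS]lnK ?posrE ?ltr0n // ler_expR ler_piMl ?ln_ge0 //.
  exact: ltW.
apply/cvgrPdist_le => eta eta0; near=> n.
have [okn Pn Tn T0 [ZP kap hk hB]] : parameters_ok theta rho C1 n.
  by near: n; exact: parameters_near.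
have f_le : failure_bound n d (compartments theta n) a b ((1 + rho) * (mean_load R n)%:R)
      (snr theta rho C1 * ln n%:R) (sparsity_count theta n)%:R (rho / 3 / (1 + rho / 3)) <= eta.
  by near: n; exact: failure_near.
have x1 : 1 <= ln (n%:R : R) by near: n; exact: near_ln.
(* Gives d <= (1 - theta) ln n <= n^(1 - theta), hence d k <= n, so that a ground truth exists. *)
have xd : d%:R / (1 - theta) <= ln (n%:R : R) by near: n; exact: near_ln.
have n0 : (0 < n)%N by apply: (@ln_nat_gt0 R); apply: lt_le_trans x1.
have nR : 1 <= n%:R :> R by rewrite ler1n.
have kn i : (k n i <= sparsity_count theta n)%N.
  by rewrite /k /sparsity_count le_truncn // ler_powR.
have gt0 : (0 < #|ground_truths n (k n)|)%N.
  apply: ground_truths_gt0; rewrite -(ler_nat R).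
  apply: (@le_trans _ _ (d * sparsity_count theta n)%N%:R).
    rewrite ler_nat; apply: (@leq_trans (\sum_(i < d) sparsity_count theta n)).
      exact: leq_sum.
    by rewrite sum_nat_const card_ord.
  rewrite natrM -[leRHS]lnK ?posrE ?ltr0n //.
  have -> : ln (n%:R : R) = (1 - theta) * ln n%:R + theta * ln n%:R by ring.
  rewrite expRD; apply: ler_pM => //; last exact: sparsity_count_le.
  apply: le_trans (expR_ge1Dx _); rewrite ler_wpDl //.
  by rewrite mulrC -ler_pdivrMr // subr_gt0.
have mE : m n = (positions theta n * (tests_per_position C1 n).+1)%N.
  by rewrite /m /ok (_ : C = C1 * (1 + rho)) ?okn // /C1 divfK // gt_eqF.
rewrite mE.
have LP := positions_gt theta n.
have := @success_probability_ge R n d (compartments theta n) (positions theta n)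
  (tests_per_position C1 n) a b (k n) ((1 + rho) * (mean_load R n)%:R)
  (snr theta rho C1 * ln n%:R) (sparsity_count theta n)%:R (rho / 3 / (1 + rho / 3))
  Tn T0 LP Pn ab b0 kap ZP.
have le1 := success_probability_le1 (k n) (@decode_labels a b n _ d (k n))
  (design_law_pmf R n (positions theta n * (tests_per_position C1 n).+1) (compartments theta n) (tests_per_position C1 n)).
move=> /(_ _ _ _ gt0) ge.
rewrite ger0_norm ?subr_ge0 // lerBlDl -lerBlDr.
apply: le_trans (ge _ _ _); first by rewrite lerD2l lerN2.
- have /andP[r0 r1] := r01; rewrite divr_ge0 ?addr_ge0 ?divr_ge0 //; exact: ltW.
- exact: ler0n.
- by move=> i; rewrite ler_nat.
Unshelve. all: by end_near. Qed.
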